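(* Let $d\ge2$ and let $C$ be a $d$-dimensional Archimedean copula. Then $C$ is singular with respect to $\lambda_d$ if, and only if, for every $\ell\in\{1,\ldots,d-1\}$ the $\ell$-Markov kernel $K_C$ of $C$ is singular with respect to $\lambda_{d-\ell}$, i.e. there exists a set $\Lambda\in\mathcal{B}(\mathbb{I}^\ell)$ with $\mu_{C^{1:\ell}}(\Lambda)=1$ such that for all $\mathbf{x}\in\Lambda$ the measure $K_C(\mathbf{x},\cdot)$ is singular with respect to $\lambda_{d-\ell}$.
   Context: $\mathbb{I}=[0,1]$; $\lambda_m$ is Lebesgue measure on $\mathcal{B}(\mathbb{I}^m)$. For a $d$-dimensional copula $C$, $\mu_C$ is the probability measure on $\mathbb{I}^d$ with $\mu_C([\mathbf{0},\mathbf{x}])=C(\mathbf{x})$; $C$ is called singular with respect to $\lambda_d$ if $\mu_C$ is. $C^{1:\ell}(\mathbf{x})=C(\mathbf{x},1,\ldots,1)$, $\mathbf{x}\in\mathbb{I}^\ell$, and $\mu_{C^{1:\ell}}$ is the induced measure (Lebesgue measure for $\ell=1$). The $\ell$-Markov kernel $K_C:\mathbb{I}^\ell\times\mathcal{B}(\mathbb{I}^{d-\ell})\to\mathbb{I}$ is (a version of) the regular conditional distribution of $(X_{\ell+1},\ldots,X_d)$ given $(X_1,\ldots,X_\ell)$, where $(X_1,\ldots,X_d)\sim C$. Archimedean copulas: a generator is a continuous, non-increasing function $\psi:[0,\infty)\to\mathbb{I}$ with $\psi(0)=1$, $\lim_{z\to\infty}\psi(z)=0$, strictly decreasing on $[0,\inf\{z\in[0,\infty]:\psi(z)=0\}]$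 (with $\psi(\infty):=0$). $\varphi:(0,1]\to[0,\infty)$ denotes the pseudoinverse of $\psi$, and $\varphi(0):=\inf\{z\in[0,\infty]:\psi(z)=0\}\in(0,\infty]$. A $d$-dimensional copula $C$ is Archimedean if $C(\mathbf{x})=\psi(\varphi(x_1)+\cdots+\varphi(x_d))$ for all $\mathbf{x}\in\mathbb{I}^d$ for some generator $\psi$. The right-hand side is a copula if and only if $\psi$ is $d$-monotone: $\psi$ is continuous on $[0,\infty)$, has derivatives $\psi^{(m)}$ up to order $d-2$ on $(0,\infty)$ with $(-1)^m\psi^{(m)}\ge0$ for $m=0,\ldots,d-2$, and $(-1)^{d-2}\psi^{(d-2)}$ is non-increasing and convex on $(0,\infty)$. *)

(* Defs.v *)
From HB Require Import structures.
From mathcomp Require Import all_boot all_order all_algebra.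
From mathcomp Require Import all_classical all_reals all_analysis.

Set Implicit Arguments.
Unset Strict Implicit.
Unset Printing Implicit Defensive.

Import Order.TTheory GRing.Theory Num.Theory numFieldNormedType.Exports.
Local Open Scope classical_set_scope.
Local Open Scope ring_scope.

(* The cube I^n is a Borel subset of R^n = n.-tuple R. Functions on I^n are
   represented by functions on n.-tuple R of which only the values on the cube
   are used, and measures on B(I^n) by Borel measures carried by the cube. *)
Definition cube {R : realType} (n : nat) : set (n.-tuple R) :=
  [set x | forall i, 0 <= tnth x i <= 1].

Definition box0 {R : realType} (n : nat) (x : n.-tuple R) : set (n.-tuple R) :=
  [set z | forall i, 0 <= tnth z i <= tnth x i].

Lemma measurable_cube {R : realType} (n : nat) : measurable (@cube R n).
Proof.
have -> : @cube R n =
    \bigcap_(i in [set: 'I_n]) ((fun x => tnth x i) @^-1` `[0, 1]%classic).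
  apply/seteqP; split=> x /= cx i; first by move=> _; rewrite /= in_itv; exact: cx.
  by have := cx i Logic.I; rewrite /= in_itv.
apply: fin_bigcap_measurable; first exact: finite_finset.
move=> i _; rewrite -[X in measurable X]setTI.
by apply: measurable_tnth => //; exact: measurable_itv.
Qed.

(* lebesgue_measure is declared on measurableTypeR R, which has the Borel sets
   of R but another display; here it is declared on R itself. *)
Definition lebesgueR {R : realType} : set R -> \bar R := @lebesgue_measure R.

Section lebesgueR_measure.
Context {R : realType}.

Let lebesgueR0 : @lebesgueR R set0 = 0%E.
Proof. exact: (@measure0 _ _ _ (@lebesgue_measure R)). Qed.

Let lebesgueR_ge0 A : (0 <= @lebesgueR R A)%E.
Proof. exact: (@measure_ge0 _ _ _ (@lebesgue_measure R)). Qed.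

Let lebesgueR_sigma_additive : semi_sigma_additive (@lebesgueR R).
Proof. exact: (@measure_semi_sigma_additive _ _ _ (@lebesgue_measure R)). Qed.

HB.instance Definition _ := isMeasure.Build _ _ _ (@lebesgueR R)
  lebesgueR0 lebesgueR_ge0 lebesgueR_sigma_additive.

Let lebesgueR_sigma_finite : sigma_finite setT (@lebesgueR R).
Proof. exact: (@sigma_finiteT _ _ _ (@lebesgue_measure R)). Qed.

HB.instance Definition _ := Measure_isSigmaFinite.Build _ _ _ (@lebesgueR R)
  lebesgueR_sigma_finite.

End lebesgueR_measure.

Section lebesgue_tuple.
Context {R : realType}.

Definition tuple_of_pair (n : nat) (p : R * n.-tuple R) : n.+1.-tuple R :=
  [the n.+1.-tuple R of p.1 :: p.2].

Lemma measurable_tuple_of_pair (n : nat) :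
  measurable_fun [set: R * n.-tuple R] (@tuple_of_pair n).
Proof. exact: measurable_cons. Qed.

Definition lebesgue_cons (n : nat)
    (m : {sigma_finite_measure set (n.-tuple R) -> \bar R}) :
    set (n.+1.-tuple R) -> \bar R :=
  pushforward (lebesgueR \x m)%E (@tuple_of_pair n).

Section lebesgue_cons_measure.
Variables (n : nat) (m : {sigma_finite_measure set (n.-tuple R) -> \bar R}).

Let lc0 : lebesgue_cons m set0 = 0%E.
Proof. by rewrite /lebesgue_cons /pushforward preimage_set0 measure0. Qed.

Let lc_ge0 A : (0 <= lebesgue_cons m A)%E.
Proof. by rewrite /lebesgue_cons /pushforward measure_ge0. Qed.

Let lc_sigma_additive : semi_sigma_additive (lebesgue_cons m).
Proof.
move=> F mF tF mUF; rewrite /lebesgue_cons /pushforward preimage_bigcup.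
have mpre B : measurable B -> measurable (@tuple_of_pair n @^-1` B).
  by move=> mB; rewrite -[X in measurable X]setTI; exact: measurable_tuple_of_pair.
apply: measure_semi_sigma_additive.
- by move=> k; exact: mpre.
- apply/trivIsetP => /= i j _ _ ij; rewrite -preimage_setI.
  by move/trivIsetP : tF => /(_ _ _ _ _ ij) ->//; rewrite preimage_set0.
- by rewrite -preimage_bigcup; exact: mpre.
Qed.

HB.instance Definition _ := isMeasure.Build _ _ _ (lebesgue_cons m)
  lc0 lc_ge0 lc_sigma_additive.

Let lc_sigma_finite : sigma_finite setT (lebesgue_cons m).
Proof.
have /sigma_finiteP[F [UF ndF Ffin]] := sigma_finiteT (@lebesgueR R).
have /sigma_finiteP[G [UG ndG Gfin]] := sigma_finiteT m.
pose g (x : n.+1.-tuple R) : R * n.-tuple R := (thead x, [tuple of behead x]).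
have gK p : g (tuple_of_pair p) = p.
  by case: p => a t; congr pair; apply: val_inj.
have mg : measurable_fun setT g.
  by apply/measurable_fun_pair; [exact: measurable_tnth|exact: measurable_behead].
exists (fun k => g @^-1` (F k `*` G k)).
  apply/seteqP; split=> // x _.
  have [i _ Fi] : (\bigcup_i F i) (g x).1 by rewrite -UF.
  have [j _ Gj] : (\bigcup_i G i) (g x).2 by rewrite -UG.
  exists (maxn i j) => //; split.
    by move: (g x).1 Fi; exact/subsetPset/ndF/leq_maxl.
  by move: (g x).2 Gj; exact/subsetPset/ndG/leq_maxr.
move=> k; have [mF Foo] := Ffin k; have [mG Goo] := Gfin k; split.
  by rewrite -[X in measurable X]setTI; apply: mg => //; exact: measurableX.
rewrite /lebesgue_cons /pushforward -comp_preimage.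
rewrite (_ : g \o _ = id); last by apply/funext => p; exact: gK.
by rewrite preimage_id product_measure1E// lte_mul_pinfty// ge0_fin_numE.
Qed.

HB.instance Definition _ := Measure_isSigmaFinite.Build _ _ _
  (lebesgue_cons m) lc_sigma_finite.

End lebesgue_cons_measure.

Fixpoint lebesgue_tuple (n : nat) :
    {sigma_finite_measure set (n.-tuple R) -> \bar R} :=
  match n with
  | 0 => [the {sigma_finite_measure set (0.-tuple R) -> \bar R} of
           \d_([tuple] : 0.-tuple R)]
  | n'.+1 => [the {sigma_finite_measure set (n'.+1.-tuple R) -> \bar R} of
           lebesgue_cons (lebesgue_tuple n')]
  end.

Definition lebesgue_cube (n : nat) : set (n.-tuple R) -> \bar R :=
  mrestr (lebesgue_tuple n) (@measurable_cube R n).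

End lebesgue_tuple.

Definition mutually_singular d (T : measurableType d) (R : realType)
    (m1 m2 : set T -> \bar R) : Prop :=
  exists N : set T, [/\ measurable N, m1 (~` N) = 0%E & m2 N = 0%E].

Section copula.
Context {R : realType}.

(* The alternating sum is the C-volume of the box [a, b]. *)
Record is_copula (d : nat) (C : d.-tuple R -> R) : Prop := IsCopula {
  copula_grounded : forall (x : d.-tuple R) (i : 'I_d),
    cube x -> tnth x i = 0 -> C x = 0;
  copula_uniform : forall (x : d.-tuple R) (i : 'I_d),
    cube x -> (forall j, j != i -> tnth x j = 1) -> C x = tnth x i;
  copula_increasing : forall a b : d.-tuple R,
    cube a -> cube b -> (forall i, tnth a i <= tnth b i) ->
    0 <= \sum_(S : {set 'I_d}) (-1) ^+ #|S| *
           C [tuple if i \in S then tnth a i else tnth b i | i < d] }.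

Definition induced_measure (d : nat) (C : d.-tuple R -> R)
    (mu : probability (d.-tuple R) R) : Prop :=
  forall x : d.-tuple R, cube x -> mu (box0 x) = (C x)%:E.

(* C^{1:l}; nth pads x with ones, and the definition is meant for l <= d. *)
Definition margin (d : nat) (C : d.-tuple R -> R) (l : nat) :
    l.-tuple R -> R :=
  fun x => C [tuple nth 1 x i | i < d].

(* The blocks (z_1, ..., z_l) and (z_{l+1}, ..., z_d), for l <= d; the default
   value 0 of nth is then never used. *)
Definition init_block (d l : nat) (z : d.-tuple R) : l.-tuple R :=
  [tuple nth 0 z i | i < l].

Definition tail_block (d l : nat) (z : d.-tuple R) : (d - l).-tuple R :=
  [tuple nth 0 z (l + i) | i < d - l].

(* K is a regular conditional distribution of the last d - l coordinates given
   the first l ones under mu, where nu is the law of the first l ones. *)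
Definition is_markov_kernel (d l : nat) (mu : probability (d.-tuple R) R)
    (nu : probability (l.-tuple R) R)
    (K : R.-pker (l.-tuple R) ~> ((d - l).-tuple R)) : Prop :=
  (forall x, cube x -> K x (@cube R (d - l)) = 1%E) /\
  (forall (E : set (l.-tuple R)) (F : set ((d - l).-tuple R)),
     measurable E -> measurable F ->
     mu [set z | E (init_block l z) /\ F (tail_block l z)] =
     \int[nu]_(x in E) K x F)%E.

Definition singular_kernel (l k : nat) (nu : probability (l.-tuple R) R)
    (K : R.-pker (l.-tuple R) ~> (k.-tuple R)) : Prop :=
  exists L : set (l.-tuple R),
    [/\ measurable L, L `<=` @cube R l, nu L = 1%E &
        forall x, L x -> mutually_singular (K x) (@lebesgue_cube R k)].

End copula.

Section archimedean.
Context {R : realType}.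

(* psi extended by psi(oo) := 0; the value at -oo is irrelevant. *)
Definition gen_ext (psi : R -> R) (z : \bar R) : R :=
  if z is r%:E then psi r else 0.

(* On (0, 1] this is the pseudoinverse of psi; at y = 0 it is the infimum of
   the zeros of psi, +oo being always one of them. *)
Definition gen_inv (psi : R -> R) (y : R) : \bar R :=
  ereal_inf [set z : \bar R | (0 <= z)%E /\ gen_ext psi z = y].

(* A function on [0, oo) is represented by psi : R -> R, of which only the
   values on [0, oo) are used. *)
Record generator (psi : R -> R) : Prop := Generator {
  gen_range : forall z : R, 0 <= z -> 0 <= psi z <= 1;
  gen_continuous : {within `[0, +oo[%classic, continuous psi};
  gen_nonincreasing : forall y z : R, 0 <= y -> y <= z -> psi z <= psi y;
  gen_at0 : psi 0 = 1;
  gen_lim : psi z @[z --> +oo] --> (0 : R);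
  gen_decreasing : forall y z : \bar R,
    (0 <= y)%E -> (y < z)%E -> (z <= gen_inv psi 0)%E ->
    gen_ext psi z < gen_ext psi y }.

Definition is_archimedean (d : nat) (C : d.-tuple R -> R) : Prop :=
  exists2 psi : R -> R, generator psi &
    forall x : d.-tuple R, cube x ->
      C x = gen_ext psi (\sum_(i < d) gen_inv psi (tnth x i))%E.

End archimedean.

(* Main.v *)
Require Import Defs.
From HB Require Import structures.
From mathcomp Require Import all_boot all_order all_algebra.
From mathcomp Require Import all_classical all_reals all_analysis.
From mathcomp Require Import measurable_realfun lra.

(** The law of a vector with distribution [C] is disintegrated into the law [nu]
    of its first [l] coordinates and the kernel [K].

    The first half of the argument holds for all disintegrations: a law on a
    product [X * Y] with marginal [nu] and kernel [K] is singular with respect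
    to the product [nu \x lam] if and only if [K x] is singular with respect to
    [lam] for [nu]-almost every [x] ([singular_disintegration_ae] and
    [ae_singular_disintegration]). One direction is Fubini: the sections of a
    set that carries the law and is null for the product carry almost every
    [K x] and are null. For the other, the part of the law that charges no null
    set has a density [f], so that the corresponding part of [K x] has density
    [f (x, _)] for almost every [x]; a singular [K x] leaves no room for it.

    What remains is to compare [nu \x lam] with Lebesgue measure on the cube.
    For [l = 1] the marginal [nu] is uniform, both are the same up to the
    identification of the spaces, and singular kernels for [l = 1] alone make
    [C] singular. For the converse, the sections of a Lebesgue-null set are null
    outside a Lebesgue-null set of [x], and this exceptional set must be null
    for [nu]. This is where the copula being Archimedean matters: for [l < d]
    the law [nu] is absolutely continuous ([init_block_abs_continuous]).

    The absolute continuity is proved without derivatives of the generator. With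
    [Y i = phi (X i)], the probability that [y i <= Y i] for all [i] is [psi] of
    the sum of the [y i]. It does not change when an amount [v] is moved from one
    coordinate to another, and therefore, with one almost surely positive spare
    coordinate [Z], the event [v <= Z, (Y 0, V) \in B] is as likely as
    [v <= Y 0, (Y 0 - v, V) \in B] ([shift_identity]). Integration over [v >= 0]
    shows that [(Y 0, V)] almost surely avoids [B] if and only if almost
    surely the set of [w <= Y 0] with [(w, V) \in B] is Lebesgue null: the law of
    [Y 0] given [V] is replaced by Lebesgue measure. Used once for sets [B] that
    only constrain [Y 0], this transfers null sets through [psi]
    ([null_preimage]); used once for each coordinate, it gives absolute
    continuity by induction ([joint_survival_abs_continuous]). *)

Set Implicit Arguments.
Unset Strict Implicit.
Unset Printing Implicit Defensive.

Import Order.TTheory GRing.Theory Num.Theory numFieldNormedType.Exports.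
Local Open Scope classical_set_scope.
Local Open Scope ring_scope.

(** * Null sets, sections and countable generation *)

Section null_sections.
Context d1 d2 (X : measurableType d1) (Y : measurableType d2) (R : realType).
Local Open Scope ereal_scope.

Lemma ge0_integral_eq0P (m : {measure set X -> \bar R}) (f : X -> \bar R) :
  measurable_fun setT f -> (forall x, 0 <= f x) ->
  \int[m]_x f x = 0 <-> {ae m, forall x, f x = 0}.
Proof.
move=> mf f0; have := ae_eq_integral_abs m measurableT mf.
under eq_integral do rewrite gee0_abs//.
move=> ->; split; apply: filterS => x; first exact.
by move=> ->.
Qed.

Lemma product_null_xsection (m1 : {measure set X -> \bar R})
    (m2 : {sigma_finite_measure set Y -> \bar R}) (A : set (X * Y)) :
  measurable A ->
  (m1 \x m2) A = 0 <-> {ae m1, forall x, m2 (xsection A x) = 0}.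
Proof.
by move=> mA; apply: ge0_integral_eq0P => //; exact: measurable_fun_xsection.
Qed.

Lemma product_null_ysection (m1 : {sigma_finite_measure set X -> \bar R})
    (m2 : {sigma_finite_measure set Y -> \bar R}) (A : set (X * Y)) :
  measurable A ->
  (m1 \x m2) A = 0 <-> {ae m2, forall y, m1 (ysection A y) = 0}.
Proof.
move=> mA; have -> : (m1 \x m2) A = (m1 \x^ m2) A.
  by apply: product_measure_unique => //= B C mB mC; rewrite product_measure2E.
have mf := measurable_fun_ysection m1 mA.
have := ae_eq_integral_abs m2 measurableT mf.
rewrite /product_measure2.
under eq_integral do rewrite gee0_abs//.
move=> ->; split; apply: filterS => x /=; first exact.
by move=> h _; rewrite h.
Qed.

End null_sections.

Section lebesgue_splitting.
Context d (T : measurableType d) (R : realType).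
Local Open Scope ereal_scope.

(** The supremum of the [m]-masses of [r]-null sets is attained, by the union of
    a maximizing sequence. Outside of the set that attains it, [m] gives no mass
    to [r]-null sets, which yields the Lebesgue decomposition of [m]. *)
Lemma largest_null_set (m : {finite_measure set T -> \bar R})
    (r : {measure set T -> \bar R}) :
  exists N, [/\ measurable N, r N = 0 &
    forall E, measurable E -> r E = 0 -> m (E `\` N) = 0].
Proof.
pose S := [set m N | N in [set N | measurable N /\ r N = 0]].
have mT : m setT \is a fin_num by apply: fin_num_measure.
have S0 : S (m set0) by exists set0 => //; split => //; exact: measure0.
have Sfin : ereal_sup S \is a fin_num.
  rewrite ge0_fin_numE; last first.
    by apply: ereal_sup_ubound; rewrite measure0 in S0.
  apply: le_lt_trans (_ : m setT < +oo); last by rewrite -ge0_fin_numE.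
  apply: ge_ereal_sup => _ [N [mN _] <-].
  by apply: le_measure; rewrite ?inE.
have ex k : exists N, [/\ measurable N, r N = 0 & ereal_sup S - k.+1%:R^-1%:E < m N].
  have k0 : (0 < k.+1%:R^-1 :> R)%R by rewrite invr_gt0.
  have [_ [N [mN rN] <-] lt] := ub_ereal_sup_adherent k0 Sfin.
  by exists N; split.
have [F FP] := choice ex.
pose N := \bigcup_k F k.
have mN : measurable N by apply: bigcupT_measurable => k; case: (FP k).
have rN : r N = 0.
  apply/(negligibleP _ mN); apply: negligible_bigcup => k.
  by have [mF rF _] := FP k; apply/negligibleP.
have supN : ereal_sup S <= m N.
  apply/lee_addgt0Pr => e e0.
  have [k _ ke] := @near_infty_natSinv_lt R (PosNum e0).
  have [mF rF lt] := FP k.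
  have FN : m (F k) <= m N by apply: le_measure; rewrite ?inE//; exact: bigcup_sup.
  have := ke k (leqnn k); rewrite /= => ke'.
  rewrite lteBlDr// in lt.
  apply: le_trans (ltW lt) _; rewrite leeD// lee_fin; exact: ltW.
exists N; split => // E mE rE.
have mEN : measurable (E `\` N) by exact: measurableD.
(* Adding [E] to [N] cannot increase the mass of [N] any more. *)
have : m (N `|` (E `\` N)) <= ereal_sup S.
  apply: ereal_sup_ubound; exists (N `|` (E `\` N)) => //; split.
    exact: measurableU.
  apply/negligibleP; first exact: measurableU.
  apply: negligibleU; apply/negligibleP => //.
  by apply: (subset_measure0 mEN mE) => // x [].
rewrite measureU//; last first.
  by apply/seteqP; split => // x [Nx [_ /(_ Nx)]].
move=> /le_trans/(_ supN); rewrite addeC -leeBrDr; last exact: fin_num_measure.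
rewrite subee ?fin_num_measure// => h; apply/eqP; rewrite eq_le h/=.
exact: measure_ge0.
Qed.

End lebesgue_splitting.

Section countably_generated.
Context d (T : measurableType d) (R : realType).
Local Open Scope ereal_scope.

(** The generating system is a sequence so that an equality that holds almost
    surely for each of its members holds almost surely for all measurable sets
    at once. *)
Lemma eq_finite_measure_gen (G : (set T)^nat)
    (mG : measurable = <<s range G >>) (GI : setI_closed (range G))
    (G0 : G 0%N = setT) (m1 m2 : {measure set T -> \bar R}) :
  m1 setT < +oo -> (forall n, m1 (G n) = m2 (G n)) ->
  forall A, measurable A -> m1 A = m2 A.
Proof.
move=> m1oo m12; apply: (measure_unique (range G) (fun=> setT)) => //.
- by move=> _; exists 0%N.
- by rewrite bigcup_const.
- by move=> _ [n _ <-].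
Qed.

End countably_generated.

(** * Singularity of a law and of its kernel *)

Section disintegration.
Context d1 d2 (X : measurableType d1) (Y : measurableType d2) (R : realType).
Variables (nu : probability X R) (K : R.-pker X ~> Y).
Local Open Scope ereal_scope.

Definition mixture (A : set (X * Y)) : \bar R := \int[nu]_x K x (xsection A x).

Lemma measurable_kernel_xsection (A : set (X * Y)) : measurable A ->
  measurable_fun setT (fun x => K x (xsection A x)).
Proof.
by move=> mA; apply: measurable_fun_xsection_finite_kernel; rewrite inE.
Qed.

Let mixture0 : mixture set0 = 0.
Proof. by apply: integral0_eq => x _; rewrite xsection0 measure0. Qed.

Let mixture_ge0 A : 0 <= mixture A.
Proof. by apply: integral_ge0 => x _; exact: measure_ge0. Qed.

Let mixture_sigma_additive : semi_sigma_additive mixture.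
Proof.
move=> F mF tF mUF.
rewrite [X in _ --> X](_ : _ = \sum_(n <oo) mixture (F n)).
  by apply/cvg_closeP; split; [exact: is_cvg_nneseries|rewrite closeE].
rewrite -integral_nneseries//; last first.
  by move=> n; exact: measurable_kernel_xsection.
apply: eq_integral => x _; apply/esym/cvg_lim => //=; rewrite xsection_bigcup.
apply: (measure_sigma_additive _ (trivIset_xsection tF)) => ?.
exact: measurable_xsection.
Qed.

HB.instance Definition _ := isMeasure.Build _ _ _ mixture
  mixture0 mixture_ge0 mixture_sigma_additive.

Lemma mixtureX (E : set X) (F : set Y) : measurable E -> measurable F ->
  mixture (E `*` F) = \int[nu]_(x in E) K x F.
Proof.
move=> mE mF; rewrite /mixture [RHS]integral_mkcond; apply: eq_integral => x _.
rewrite patchE; case: ifPn => xE; first by rewrite in_xsectionX.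
by rewrite notin_xsectionX// measure0.
Qed.

(** Both sides are measures that agree on the rectangles. *)
Lemma disintegration (m : {measure set (X * Y) -> \bar R}) :
  (forall (E : set X) (F : set Y), measurable E -> measurable F ->
    m (E `*` F) = \int[nu]_(x in E) K x F) ->
  forall A, measurable A -> m A = \int[nu]_x K x (xsection A x).
Proof.
move=> mE A mA; rewrite -/(mixture A).
pose G : set (set (X * Y)) :=
  [set C | exists E, measurable E /\ exists F, measurable F /\ C = E `*` F].
have XT : [set: X * Y] = setT `*` setT by rewrite setXTT.
apply: (measure_unique G (fun=> setT)) => //.
- rewrite measurable_prod_measurableType //; congr (<<s _ >>).
  rewrite predeqE; split => [[E mE' [F mF <-]]|[E [mE' [F [mF ->]]]]].
    by exists E; split => //; exists F.
  by exists E => //; exists F.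
- move=> /= _ _ [X1 [mX1 [X2 [mX2 ->]]]] [Y1 [mY1 [Y2 [mY2 ->]]]].
  rewrite -setXI; exists (X1 `&` Y1); split; first exact: measurableI.
  by exists (X2 `&` Y2); split => //; exact: measurableI.
- by move=> i; exists setT; split => //; exists setT; split.
- by rewrite bigcup_const.
- by move=> _ [E [mE' [F [mF ->]]]]; rewrite mE//= mixtureX.
- move=> _; rewrite XT mE//.
  apply: (@le_lt_trans _ _ (\int[nu]_x 1)).
    apply: ge0_le_integral => //; first exact: measurable_kernel.
    by move=> x _; rewrite prob_kernel.
  by rewrite integral_cst// mul1e -ge0_fin_numE// fin_num_measure.
Qed.

End disintegration.

Section density_measure.
Context d (T : measurableType d) (R : realType).
Variables (m : {measure set T -> \bar R}) (f : T -> \bar R).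
Hypotheses (mf : measurable_fun setT f) (f0 : forall x, (0 <= f x)%E).
Local Open Scope ereal_scope.

(** The two unnamed arguments are what makes the integral a measure in the set
    [A]; they let the measure structure be inferred. *)
Definition density_measure (_ : measurable_fun setT f)
    (_ : forall x, (0 <= f x)%E) (A : set T) : \bar R := \int[m]_(x in A) f x.

Let dm0 : density_measure mf f0 set0 = 0.
Proof. exact: integral_set0. Qed.

Let dm_ge0 A : 0 <= density_measure mf f0 A.
Proof. by apply: integral_ge0 => x _; exact: f0. Qed.

Let dm_sigma_additive : semi_sigma_additive (density_measure mf f0).
Proof. exact: semi_sigma_additive_nng_induced. Qed.

HB.instance Definition _ := isMeasure.Build _ _ _ (density_measure mf f0)
  dm0 dm_ge0 dm_sigma_additive.

End density_measure.

Section singular_disintegration.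
Context d1 d2 (X : measurableType d1) (Y : measurableType d2) (R : realType).
Variables (nu : probability X R) (K : R.-pker X ~> Y).
Variable lam : {finite_measure set Y -> \bar R}.
Variable m : {finite_measure set (X * Y)%type -> \bar R}.
Local Open Scope ereal_scope.
Hypothesis mK : forall (E : set X) (F : set Y), measurable E -> measurable F ->
  m (E `*` F) = \int[nu]_(x in E) K x F.

(** The sections of a null set that carries [m] witness the singularity of the
    kernel. *)
Lemma singular_disintegration_ae :
  mutually_singular m (nu \x lam) ->
  {ae nu, forall x, mutually_singular (K x) lam}.
Proof.
move=> [N [mN N0 N1]].
have mNC := measurableC mN.
have := disintegration mK mNC; rewrite [LHS]N0 => /esym.
move=> /ge0_integral_eq0P => /(_ (measurable_kernel_xsection K mNC)).
move=> /(_ (fun=> measure_ge0 _ _)) h0.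
have h1 := (product_null_xsection nu lam mN).1 N1.
apply: filterS2 h0 h1 => x h0 h1; exists (xsection N x); split => //.
- exact: measurable_xsection.
- by rewrite -h0 /=; congr (K x _); rewrite !xsectionE preimage_setC.
Qed.

(** Let [N] be a largest null set. Off [N] the law has a density [f], so that
    for each fixed set [G n] the part of [K x] off [N] gives to [G n] the integral of
    [f (x, _)] for almost every [x]. As the [G n] are countably many and
    generate, almost every [K x] has density [f (x, _)] off [N]; being singular it
    vanishes there. *)
Lemma ae_singular_disintegration (G : (set Y)^nat)
    (mG : measurable = <<s range G >>) (GI : setI_closed (range G))
    (G0 : G 0%N = setT) :
  {ae nu, forall x, mutually_singular (K x) lam} ->
  mutually_singular m (nu \x lam).
Proof.
move=> sK; have [N [mN N0 NP]] := largest_null_set m (nu \x lam).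
have mNC := measurableC mN.
exists N; split => //.
pose mA : {finite_measure set (X * Y)%type -> \bar R} := mrestr m mNC.
have fin_r : fin_num_fun (nu \x lam).
  apply: lty_fin_num_fun; rewrite -setXTT [ltLHS]product_measure1E//.
  by rewrite lte_mul_pinfty// -?ge0_fin_numE// fin_num_measure.
pose r : {finite_measure set (X * Y)%type -> \bar R} :=
  HB.pack (nu \x lam) (@Measure_isFinite.Build _ _ _ (nu \x lam) fin_r).
have dom : mA `<< r.
  apply/null_content_dominatesP => E mE E0.
  by rewrite /mA /= /mrestr -setDE; exact: NP.
pose f := Radon_Nikodym_SigmaFinite.f mA r.
have f0 z : 0 <= f z by exact: Radon_Nikodym_SigmaFinite.f_ge0.
have mf : measurable_fun setT f.
  by apply: (measurable_int r); exact: Radon_Nikodym_SigmaFinite.f_integrable.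
have mfx x : measurable_fun setT (fun y => f (x, y)).
  by apply: measurableT_comp mf _; exact: pair1_measurable.
have fx0 x y : 0 <= f (x, y) by [].
have msec x : measurable (xsection (~` N) x) by exact: measurable_xsection.
(* The exceptional null set depends on [n]. *)
have rho_sig n : {ae nu, forall x,
    K x (xsection (~` N) x `&` G n) = \int[lam]_(y in G n) f (x, y)}.
  have mGn : measurable (G n).
    by rewrite mG; apply: sub_sigma_algebra; exists n.
  have mNG : measurable (~` N `&` setT `*` G n).
    by apply: measurableI => //; exact: measurableX.
  have secE x : xsection (~` N `&` setT `*` G n) x = xsection (~` N) x `&` G n.
    by rewrite xsectionI [X in _ `&` X]in_xsectionX// in_setT.
  have mKx : measurable_fun setT (fun x => K x (xsection (~` N) x `&` G n)).
    under eq_fun do rewrite -secE.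
    exact: measurable_kernel_xsection.
  have mfG : measurable_fun setT (f \_ (setT `*` G n)).
    apply/(measurable_restrictT _ _).1 => //; first exact: measurableX.
    exact: measurable_funTS.
  have fG0 z : 0 <= (f \_ (setT `*` G n)) z by rewrite patchE; case: ifP.
  have fGE x : \int[lam]_y (f \_ (setT `*` G n)) (x, y) =
      \int[lam]_(y in G n) f (x, y).
    rewrite [RHS]integral_mkcond; apply: eq_integral => y _; rewrite !patchE.
    by rewrite in_setX/= in_setT.
  have mfGx : measurable_fun setT (fun x => \int[lam]_(y in G n) f (x, y)).
    under eq_fun do rewrite -fGE.
    exact: (measurable_fun_fubini_tonelli_F (m2 := lam) _ mfG fG0).
  have : ae_eq nu setT (fun x => K x (xsection (~` N) x `&` G n))
                       (fun x => \int[lam]_(y in G n) f (x, y)).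
    apply: integral_ae_eq => //.
    - apply/integrableP; split => //.
      apply: (@le_lt_trans _ _ (\int[nu]_x 1)).
        apply: ge0_le_integral => //; first exact: measurableT_comp.
        move=> x _; rewrite gee0_abs// -(prob_kernel (s := K) x).
        by apply: le_measure; rewrite ?inE//; exact: measurableI.
      by rewrite integral_cst// mul1e -ge0_fin_numE// fin_num_measure.
    move=> E _ mE.
    have mEG : measurable (E `*` G n) by exact: measurableX.
    transitivity (mA (E `*` G n)).
      rewrite /mA/= /mrestr (disintegration mK); last exact: measurableI.
      rewrite [LHS]integral_mkcond; apply: eq_integral => x _.
      rewrite xsectionI patchE; case: ifPn => xE.
        by rewrite in_xsectionX// setIC.
      by rewrite notin_xsectionX// set0I measure0.
    rewrite (Radon_Nikodym_SigmaFinite.f_integral dom)// -/f.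
    rewrite [LHS]integral_mkcond [LHS](fubini_tonelli1 (m1 := nu) (m2 := lam))//;
      last 2 first.
    - apply/(measurable_restrictT _ _).1 => //; exact: measurable_funTS.
    - by move=> z; rewrite patchE; case: ifP.
    rewrite [RHS]integral_mkcond; apply: eq_integral => x _.
    rewrite /fubini_F patchE; case: ifPn => xE.
      rewrite [RHS]integral_mkcond; apply: eq_integral => y _; rewrite !patchE.
      by rewrite in_setX/= xE.
    apply: integral0_eq => y _; rewrite patchE in_setX/=.
    by rewrite (negbTE xE).
  by apply: filterS => x; exact.
have /ae_foralln rho_sig' := rho_sig.
have K0 : {ae nu, forall x, K x (xsection (~` N) x) = 0}.
  apply: filterS2 sK rho_sig' => x [B [mB B0 B1]] rs.
  have eqm : forall A, measurable A ->
      mrestr (K x) (msec x) A = density_measure lam (mfx x) (fx0 x) A.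
    apply: (eq_finite_measure_gen mG GI G0).
    - rewrite /= /mrestr setTI.
      apply: (@le_lt_trans _ _ (K x setT)); last by rewrite prob_kernel ltry.
      by apply: le_measure; rewrite ?inE.
    - by move=> n; rewrite /= /mrestr setIC rs.
  have := eqm _ mB; rewrite /= /mrestr /density_measure.
  rewrite [X in _ = X]null_set_integral//; last exact: measurable_funTS.
  move=> KB0.
  apply: (@subset_measure0 _ _ _ (K x) _
      ((B `&` xsection (~` N) x) `|` ~` B)) => //.
  - by apply: measurableU; [exact: measurableI|exact: measurableC].
  - by move=> y Ny; have [By|nBy] := pselect (B y); [left|right].
  - apply/negligibleP.
      by apply: measurableU; [exact: measurableI|exact: measurableC].
    apply: negligibleU; apply/negligibleP => //; first exact: measurableI.
    exact: measurableC.
rewrite (disintegration mK mNC); apply/ge0_integral_eq0P => //.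
exact: measurable_kernel_xsection.
Qed.

End singular_disintegration.

(** * Tuples: orthants, blocks and null sections *)

Section orthants.
Context {R : realType} (n : nat).

Definition upper_orthant (b : n.-tuple R) : set (n.-tuple R) :=
  [set z | forall i, tnth b i <= tnth z i].

(** Rational corners make the generating system countable, as almost sure
    equality on all of its members requires. The whole space is its first member,
    so that finite measures that agree on the system have the same mass. *)
Definition rat_orthant (m : nat) : set (n.-tuple R) :=
  if m is m'.+1 then
    if (unpickle m' : option (n.-tuple rat)) is Some b then
      upper_orthant [tuple ratr (tnth b i) | i < n]
    else setT
  else setT.

Lemma rat_orthantE (b : n.-tuple rat) :
  rat_orthant (pickle b).+1 = upper_orthant [tuple ratr (tnth b i) | i < n].
Proof. by rewrite /rat_orthant pickleK. Qed.

Lemma upper_orthantI (b c : n.-tuple R) : upper_orthant b `&` upper_orthant c =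
  upper_orthant [tuple Num.max (tnth b i) (tnth c i) | i < n].
Proof.
apply/seteqP; split=> z /=.
  by move=> [bz cz] i; rewrite tnth_mktuple ge_max bz cz.
by move=> h; split => i; have := h i; rewrite tnth_mktuple ge_max => /andP[].
Qed.

Lemma measurable_upper_orthant (b : n.-tuple R) : measurable (upper_orthant b).
Proof.
have -> : upper_orthant b =
    \bigcap_(i in [set: 'I_n]) ((fun x => tnth x i) @^-1` `[tnth b i, +oo[%classic).
  apply/seteqP; split=> x /= cx i; first by move=> _; rewrite /= in_itv/= andbT.
  by have := cx i Logic.I; rewrite /= in_itv/= andbT.
apply: fin_bigcap_measurable; first exact: finite_finset.
move=> i _; rewrite -[X in measurable X]setTI.
by apply: measurable_tnth => //; exact: measurable_itv.
Qed.

Lemma rat_orthantI : setI_closed (range rat_orthant).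
Proof.
move=> _ _ [p _ <-] [q _ <-]; rewrite /rat_orthant.
case: p => [|p]; first by rewrite setTI; exists q.
case: (unpickle p) => [b|]; last by rewrite setTI; exists q.
case: q => [|q]; first by rewrite setIT; exists (pickle b).+1; rewrite // pickleK.
case: (unpickle q) => [c|]; last first.
  by rewrite setIT; exists (pickle b).+1; rewrite // pickleK.
exists (pickle [tuple Num.max (tnth b i) (tnth c i) | i < n]).+1 => //.
rewrite pickleK upper_orthantI; congr upper_orthant; apply: eq_from_tnth => i.
rewrite !tnth_mktuple; have [h|/ltW h] := leP (tnth b i) (tnth c i).
  by rewrite max_r// ler_rat.
by rewrite max_l// ler_rat.
Qed.

(** A half space [x < z i] is the union, over the rational [q > x] and over [k],
    of the orthants with corner [q] in the direction [i] and [- k] in the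
    others. *)
Lemma rat_orthant_gen : measurable = <<s range rat_orthant >>.
Proof.
apply/seteqP; split.
  apply: smallest_sub; first exact: smallest_sigma_algebra.
  pose GT := g_sigma_algebraType (range rat_orthant).
  move=> A; rewrite -bigcup_seq /= => -[i _ [B mB <-]].
  suff : measurable_fun [set: GT] (fun z : GT => tnth (z : n.-tuple R) i).
    by move=> /(_ measurableT _ mB).
  apply: (measurability _ (RGenOInfty.measurableE R)).
  move=> _ [_ [x ->] <-]; rewrite setTI.
  rewrite (_ : _ @^-1` _ = \bigcup_(q : rat) \bigcup_k
      [set z : n.-tuple R | (x < ratr q) /\ upper_orthant
        [tuple (if j == i then ratr q else - k%:R) | j < n] z]); last first.
    apply/seteqP; split=> z /=; rewrite in_itv/= andbT.
      move=> /rat_in_itvoo[q]; rewrite in_itv/= => /andP[xq qz].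
      exists q => //.
      pose M := \sum_(j < n) `|tnth z j|.
      exists (Num.bound M) => //; split => // j; rewrite tnth_mktuple.
      case: eqVneq => [->|ji]; first exact: ltW.
      have zM : `|tnth z j| <= M.
        rewrite /M (bigD1 j)//= lerDl; exact: sumr_ge0.
      have Mb : M < (Num.bound M)%:R.
        by apply: archi_boundP; apply: sumr_ge0.
      rewrite lerNl (le_trans _ (ltW Mb))// (le_trans _ zM)//.
      by rewrite -normrN ler_norm.
    move=> [q _ [k _ [xq h]]]; rewrite (lt_le_trans xq)//.
    by have := h i; rewrite tnth_mktuple eqxx.
  apply: bigcupT_measurable_rat => q; apply: bigcupT_measurable => k.
  have [xq|xq] := ltP x (ratr q); last first.
    rewrite (_ : [set _ | _] = set0); last by apply/seteqP; split => z //= [].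
    exact: (@measurable0 _ GT).
  apply: sub_sigma_algebra.
  exists (pickle [tuple (if j == i then q else - k%:R) | j < n]).+1 => //.
  rewrite rat_orthantE; apply/seteqP; split => z /=.
    move=> h; split => // j; have := h j; rewrite !tnth_mktuple.
    by case: ifP => // _; rewrite rmorphN/= ratr_nat.
  move=> [_ h] j; have := h j; rewrite !tnth_mktuple.
  by case: ifP => // _; rewrite rmorphN/= ratr_nat.
apply: smallest_sub; first exact: sigma_algebra_measurable.
move=> _ [[|m] _ <-] //=; case: unpickle => [b|//].
exact: measurable_upper_orthant.
Qed.

Lemma eq_finite_measure_orthant (m1 m2 : {measure set (n.-tuple R) -> \bar R}) :
  (m1 setT < +oo)%E -> m1 setT = m2 setT ->
  (forall b, m1 (upper_orthant b) = m2 (upper_orthant b)) ->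
  forall A, measurable A -> m1 A = m2 A.
Proof.
move=> m1oo mT mO; apply: (eq_finite_measure_gen rat_orthant_gen rat_orthantI) => //.
by case=> [//|m] /=; case: unpickle.
Qed.

End orthants.

Section blocks.
Context {R : realType}.

Lemma measurable_nth (n i : nat) :
  measurable_fun setT (fun z : n.-tuple R => nth 0 z i).
Proof.
have [ni|ni] := ltnP i n; last first.
  rewrite (_ : (fun z => _) = cst 0); first exact: measurable_cst.
  by apply/funext => z; rewrite nth_default// size_tuple.
rewrite (_ : (fun z => _) = fun z : n.-tuple R => tnth z (Ordinal ni)).
  exact: measurable_tnth.
by apply/funext => z; rewrite (tnth_nth 0).
Qed.

Lemma measurable_mktuple d (T : measurableType d) (n : nat) (f : 'I_n -> T -> R) :
  (forall i, measurable_fun setT (f i)) ->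
  measurable_fun setT (fun t => [tuple f i t | i < n]).
Proof.
move=> mf; apply/measurable_fun_tnthP => i.
rewrite (_ : _ \o _ = f i)//; apply/funext => t /=.
by rewrite tnth_mktuple.
Qed.

Lemma measurable_init_block (d l : nat) :
  measurable_fun setT (@init_block R d l).
Proof. by apply: measurable_mktuple => i; exact: measurable_nth. Qed.

Lemma measurable_tail_block (d l : nat) :
  measurable_fun setT (@tail_block R d l).
Proof. by apply: measurable_mktuple => i; exact: measurable_nth. Qed.

(** Inverse of the splitting of a tuple into [init_block] and [tail_block]. *)
Definition merge_blocks (d l : nat) (p : l.-tuple R * (d - l).-tuple R) : d.-tuple R :=
  [tuple if (i < l)%N then nth 0 p.1 i else nth 0 p.2 (i - l) | i < d].

Lemma measurable_merge (d l : nat) : measurable_fun setT (@merge_blocks d l).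
Proof.
apply: measurable_mktuple => i; case: (ltnP i l) => _.
  exact: (measurableT_comp (@measurable_nth l i) measurable_fst).
exact: (measurableT_comp (@measurable_nth (d - l) (i - l)) measurable_snd).
Qed.

Lemma nth_mktuple_nat (n : nat) (f : nat -> R) (i : nat) : (i < n)%N ->
  nth 0 [tuple f i | i < n] i = f i.
Proof.
move=> ni; rewrite -[i]/(nat_of_ord (Ordinal ni)) -tnth_nth.
by rewrite tnth_mktuple.
Qed.

Variables (d l : nat).
Hypothesis ld : (l <= d)%N.

Lemma nth_merge_blocks (p : l.-tuple R * (d - l).-tuple R) i : (i < d)%N ->
  nth 0 (merge_blocks p) i = if (i < l)%N then nth 0 p.1 i else nth 0 p.2 (i - l).
Proof.
move=> id.
exact: (@nth_mktuple_nat d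
  (fun i => if (i < l)%N then nth 0 p.1 i else nth 0 p.2 (i - l))).
Qed.

Lemma merge_blocksK (z : d.-tuple R) : merge_blocks (init_block l z, tail_block l z) = z.
Proof.
apply: eq_from_tnth => i; rewrite tnth_mktuple/=; case: ltnP => il.
  by rewrite (@nth_mktuple_nat l (nth 0 z))// -tnth_nth.
rewrite (@nth_mktuple_nat (d - l) (fun j => nth 0 z (l + j))); last first.
  by rewrite ltn_sub2rE.
by rewrite subnKC// -tnth_nth.
Qed.

Lemma cube_nthP (n : nat) (z : n.-tuple R) :
  cube z <-> forall i, (i < n)%N -> 0 <= nth 0 z i <= 1.
Proof.
split=> h i; last by rewrite (tnth_nth 0); exact: h.
by move=> ni; have := h (Ordinal ni); rewrite (tnth_nth 0).
Qed.

Lemma cube_merge p : cube (@merge_blocks d l p) <-> cube p.1 /\ cube p.2.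
Proof.
split=> [/cube_nthP h|[/cube_nthP h1 /cube_nthP h2]].
  split; apply/cube_nthP => i il.
    by have := h _ (leq_trans il ld); rewrite nth_merge_blocks ?il// (leq_trans il).
  have ild : (l + i < d)%N by rewrite -ltn_subRL.
  by have := h _ ild; rewrite nth_merge_blocks// ltnNge leq_addr/= addKn.
apply/cube_nthP => i id; rewrite nth_merge_blocks//; case: ltnP => il; first exact: h1.
by apply: h2; rewrite ltn_sub2rE.
Qed.

End blocks.

Section lebesgue_null.
Context {R : realType}.
Local Open Scope ereal_scope.

Lemma lebesgue_tuple_consE (n : nat) (A : set (n.+1.-tuple R)) :
  lebesgue_tuple n.+1 A =
  (lebesgueR \x lebesgue_tuple n) (@tuple_of_pair R n @^-1` A).
Proof. by []. Qed.

Lemma measurable_tuple_of_pair_preimage (n : nat) (A : set (n.+1.-tuple R)) :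
  measurable A -> measurable (@tuple_of_pair R n @^-1` A).
Proof.
by move=> mA; rewrite -[X in measurable X]setTI; exact: measurable_tuple_of_pair.
Qed.

Lemma measurable_merge_preimage (d l : nat) (A : set (d.-tuple R)) :
  measurable A -> measurable (@merge_blocks R d l @^-1` A).
Proof.
by move=> mA; rewrite -[X in measurable X]setTI; exact: measurable_merge.
Qed.

Lemma merge_blocks_cons (d l : nat) a (x : l.-tuple R) (t : (d - l).-tuple R) :
  @merge_blocks R d.+1 l.+1 (tuple_of_pair (a, x), t) =
  tuple_of_pair (a, merge_blocks (x, t)).
Proof.
apply: eq_from_tnth => i; rewrite tnth_mktuple/=.
case: (unliftP ord0 i) => [j ->|->]; last by [].
by rewrite /= tnthS tnth_mktuple.
Qed.

(** The recursion that defines [lebesgue_tuple] splits off one coordinate, so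
    that Fubini is used once for each coordinate of the initial block. *)
Lemma lebesgue_tuple_null_merge (l d : nat) (N : set (d.-tuple R)) :
  (l <= d)%N -> measurable N -> lebesgue_tuple d N = 0 ->
  {ae lebesgue_tuple l, forall x,
    lebesgue_tuple (d - l) (xsection (@merge_blocks R d l @^-1` N) x) = 0}.
Proof.
elim: l d N => [|l IHl] [|d] N //.
- move=> _ mN N0; apply: aeW => x; rewrite -N0; congr (_ _).
  apply/seteqP; split => z /=; rewrite /xsection/= inE/=.
    by rewrite (_ : merge_blocks _ = z)//; apply: eq_from_tnth => -[].
  by rewrite (_ : merge_blocks _ = z)//; apply: eq_from_tnth => -[].
- have gE (x : 0.-tuple R) (z : d.+1.-tuple R) : @merge_blocks R d.+1 0 (x, z) = z.
    apply: eq_from_tnth => i.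
    by rewrite tnth_mktuple [RHS](tnth_nth (0 : R)%R) /= (subn0 i).
  move=> _ mN N0; apply: aeW => x; rewrite -[RHS]N0; congr (_ _).
  by apply/seteqP; split => z /=; rewrite /xsection/= inE/= gE.
rewrite ltnS => ld mN; rewrite lebesgue_tuple_consE.
have mN' := measurable_tuple_of_pair_preimage mN.
move=> /(product_null_xsection _ _ mN').1 N0.
have mG := measurable_merge_preimage (l := l.+1) mN.
pose Q := [set z | lebesgue_tuple (d - l)
  (xsection (@merge_blocks R d.+1 l.+1 @^-1` N) z) != 0].
have mQ : measurable Q.
  rewrite /Q -[X in measurable X]setTI; apply: emeasurable_neq => //.
  exact: (measurable_fun_xsection (lebesgue_tuple (d - l)) mG).
exists Q; split => //; last by move=> z /= /eqP.
rewrite lebesgue_tuple_consE.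
have mQ' := measurable_tuple_of_pair_preimage mQ.
apply/(product_null_xsection _ _ mQ').
apply: filterS N0 => a Na.
have mNa : measurable (xsection (@tuple_of_pair R d @^-1` N) a).
  exact: measurable_xsection.
apply: (measure_negligible (measurable_xsection _ mQ')).
have := IHl _ _ ld mNa Na; apply: negligibleS => x /=.
rewrite /xsection/= inE/= => /eqP h1 h2; apply: h1; rewrite -h2.
congr (_ _); rewrite xsectionE; apply/funext => t.
by rewrite /= merge_blocks_cons in_setE /= in_setE.
Qed.

End lebesgue_null.

(** * Exchanging mass between coordinates *)

Section reflection.
Context {R : realType}.

(** Lebesgue measure is determined by its values on the half-open intervals. *)
Lemma lebesgueR_reflect (c : R) (A : set R) : measurable A ->
  lebesgueR [set v | A (c - v)] = lebesgueR A.
Proof.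
move=> mA.
pose f : measurableTypeR R -> measurableTypeR R := fun v => c - v.
have mf : measurable_fun setT f by exact: measurable_funB.
rewrite [LHS](_ : _ = pushforward (@lebesgue_measure R) f A)//.
apply/esym/(lebesgue_measure_unique (mu :=
  measure_function_pushforward__canonical__measure_function_Measure _ mf)) => //.
move=> _ [[a b]] _ <-; rewrite /= /pushforward.
rewrite (_ : f @^-1` _ = `[c - b, c - a[%classic); last first.
  apply/seteqP; split=> v /=; rewrite /f !in_itv/= => /andP[? ?]; apply/andP.
    by split; lra.
  by split; lra.
rewrite !lebesgue_measure_itv/= !lte_fin ltrD2l ltrN2.
by case: ifP => // _; congr EFin; lra.
Qed.

End reflection.

Section exchange.
Context d (T : measurableType d) {R : realType} (P : probability T R).
Variable psi : R -> R.

(** The spare coordinate [Z] is kept apart from the [Y i] so that the induction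
    that removes the coordinates [Y i] one by one leaves it unchanged. *)
Definition joint_survival (n : nat) (Z : T -> R) (Y : nat -> T -> R) : Prop :=
  forall (z : R) (y : nat -> R), 0 <= z -> (forall i, 0 <= y i) ->
  P [set t | z <= Z t /\ forall i, (i < n)%N -> y i <= Y i t] =
    (psi (z + \sum_(i < n) y i))%:E.

Definition tail_tuple (n : nat) (Y : nat -> T -> R) (t : T) : n.-tuple R :=
  [tuple Y i.+1 t | i < n].

Section shift.
Variables (n : nat) (Z : T -> R) (Y : nat -> T -> R).
Hypotheses (mZ : measurable_fun setT Z) (mY : forall i, measurable_fun setT (Y i)).
Hypotheses (Z0 : forall t, 0 <= Z t) (Y0 : forall i t, 0 <= Y i t).
Hypothesis ZY : joint_survival n.+1 Z Y.

Lemma measurable_tail_tuple : measurable_fun setT (@tail_tuple n Y).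
Proof. exact: measurable_mktuple. Qed.

Lemma measurable_ge_cst (f : T -> R) c : measurable_fun setT f ->
  measurable [set t | c <= f t].
Proof.
move=> mf; rewrite (_ : [set t | _] = f @^-1` `[c, +oo[%classic).
  by rewrite -[X in measurable X]setTI; apply: mf => //; exact: measurable_itv.
by apply/seteqP; split => t /=; rewrite in_itv/= andbT.
Qed.

(** The two laws agree on orthants, where both have mass
    [psi (v + \sum_i Num.max 0 (b i))]: the amount [v] is asked from [Z] on the
    left, and from [Y 0] on the right. *)
Lemma shift_identity (v : R) (B : set (R * n.-tuple R)) : 0 <= v -> measurable B ->
  P [set t | v <= Z t /\ B (Y 0%N t, tail_tuple n Y t)] =
  P [set t | v <= Y 0%N t /\ B (Y 0%N t - v, tail_tuple n Y t)].
Proof.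
move=> v0 mB.
pose W1 (t : T) : n.+1.-tuple R := [tuple Y i t | i < n.+1].
pose W2 (t : T) : n.+1.-tuple R :=
  [tuple (if i == 0 :> nat then Y 0%N t - v else Y i t) | i < n.+1].
have mW1 : measurable_fun setT W1 by exact: measurable_mktuple.
have mW2 : measurable_fun setT W2.
  apply: measurable_mktuple => i; case: (i == 0 :> nat) => //.
  exact: measurable_funB.
have mD1 : measurable [set t | v <= Z t] by exact: measurable_ge_cst.
have mD2 : measurable [set t | v <= Y 0%N t] by exact: measurable_ge_cst.
pose m1 := measure_function_pushforward__canonical__measure_function_Measure
  (mrestr P mD1) mW1.
pose m2 := measure_function_pushforward__canonical__measure_function_Measure
  (mrestr P mD2) mW2.
pose g (x : n.+1.-tuple R) : R * n.-tuple R := (thead x, [tuple of behead x]).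
have mg : measurable_fun setT g.
  by apply/measurable_fun_pair; [exact: measurable_tnth|exact: measurable_behead].
have m12 A : measurable A -> m1 A = m2 A.
  have m1b (b : nat -> R) : P [set t | v <= Z t /\
        forall i, (i < n.+1)%N -> b i <= Y i t] =
      (psi (v + \sum_(i < n.+1) Num.max 0 (b i)))%:E.
    rewrite -(@ZY v (fun i => Num.max 0 (b i)) v0); last first.
      by move=> i; rewrite le_max lexx.
    congr (P _); apply/seteqP; split => t /= [vZ h]; split => // i ni.
      by rewrite ge_max Y0 h.
    by have := h i ni; rewrite ge_max => /andP[].
  have m2b (b : nat -> R) : P [set t | v <= Y 0%N t /\
        forall i, (i < n.+1)%N -> b i <= (if i == 0%N then Y 0%N t - v else Y i t)] =
      (psi (v + \sum_(i < n.+1) Num.max 0 (b i)))%:E.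
    (* The condition [v <= Y 0] is absorbed: [v + Num.max 0 (b 0) <= Y 0]. *)
    pose b' i := if i == 0%N then v + Num.max 0 (b 0%N) else Num.max 0 (b i).
    have -> : v + \sum_(i < n.+1) Num.max 0 (b i) = 0 + \sum_(i < n.+1) b' i.
      by rewrite !big_ord_recl/= /b'/= add0r addrA.
    rewrite -(@ZY 0 b' (lexx 0)); last first.
      by move=> i; rewrite /b'; case: ifP => _; rewrite ?addr_ge0// le_max lexx.
    congr (P _); apply/seteqP; split => t /=.
      move=> [vY h]; split => // i ni; have := h i ni; rewrite /b'.
      case: eqVneq => [->|_ bY].
        by rewrite -lerBrDl ge_max subr_ge0 vY.
      by rewrite ge_max Y0.
    move=> [_ h]; split.
      have := h 0%N isT; rewrite /b'/= -lerBrDl ge_max subr_ge0.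
      by case/andP.
    move=> i ni; have := h i ni; rewrite /b'; case: eqVneq => [->|_].
      by rewrite -lerBrDl ge_max => /andP[].
    by rewrite ge_max => /andP[].
  apply: (eq_finite_measure_orthant (m1 := m1) (m2 := m2)).
  - rewrite /m1/= /pushforward /mrestr preimage_setT setTI.
    by apply: le_lt_trans (probability_le1 P mD1) _; rewrite ltry.
  - rewrite /m1 /m2 /= /pushforward /mrestr !preimage_setT !setTI.
    have := m1b (fun=> 0); have := m2b (fun=> 0) => <-.
    move=> h.
    transitivity (P [set t | v <= Z t /\ forall i, (i < n.+1)%N -> 0 <= Y i t]).
      by congr (P _); apply/seteqP; split => t /= => [|[]].
    rewrite h; congr (P _); apply/seteqP; split => t /=; first by case.
    by move=> vY; split => // i _; case: eqVneq => _ //; rewrite subr_ge0.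
  - move=> b; rewrite /m1 /m2 /= /pushforward /mrestr.
    transitivity (P [set t | v <= Z t /\
        forall i, (i < n.+1)%N -> nth 0 b i <= Y i t]).
      congr (P _); apply/seteqP; split => t /= [h1 h2]; split => //.
        move=> i ni; have := h1 (Ordinal ni).
        by rewrite (tnth_nth 0) tnth_mktuple.
      by move=> i; rewrite (tnth_nth 0) tnth_mktuple; exact: h2.
    rewrite m1b -m2b.
    congr (P _); apply/seteqP; split => t /= [h1 h2]; split => //.
      by move=> i; rewrite (tnth_nth 0) tnth_mktuple; exact: h2.
    move=> i ni; have := h1 (Ordinal ni).
    by rewrite (tnth_nth 0) tnth_mktuple.
have mgB : measurable (g @^-1` B) by rewrite -[X in measurable X]setTI; exact: mg.
have gW1 t : g (W1 t) = (Y 0%N t, tail_tuple n Y t).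
  rewrite /g /thead tnth_mktuple; congr pair; apply: eq_from_tnth => i.
  rewrite (tnth_nth 0) nth_behead (@nth_mktuple_nat _ n.+1 (fun i => Y i t)) ?ltnS//.
  by rewrite tnth_mktuple.
have gW2 t : g (W2 t) = (Y 0%N t - v, tail_tuple n Y t).
  rewrite /g /thead tnth_mktuple; congr pair; apply: eq_from_tnth => i.
  rewrite (tnth_nth 0) nth_behead (@nth_mktuple_nat _ n.+1
    (fun i => if i == 0%N then Y 0%N t - v else Y i t)) ?ltnS//.
  by rewrite tnth_mktuple.
have := m12 _ mgB; rewrite /m1 /m2 /= /pushforward /mrestr => h.
transitivity (P (W1 @^-1` (g @^-1` B) `&` [set t | v <= Z t])).
  by congr (P _); apply/seteqP; split => t /=; rewrite gW1 => -[].
rewrite h; congr (P _); apply/seteqP; split => t /=; rewrite gW2 => -[] //.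
Qed.


(** The region whose sections at a fixed [v] and at a fixed [t] are compared by
    Fubini: the former are the events of [shift_identity], the latter the
    reflected sets under the graph of [Y 0]. *)
Let shifted (B : set (R * n.-tuple R)) : set (R * T) :=
  [set p | [/\ 0 <= p.1, p.1 <= Y 0%N p.2 &
               B (Y 0%N p.2 - p.1, tail_tuple n Y p.2)]].

Let measurable_shifted B : measurable B -> measurable (shifted B).
Proof.
move=> mB.
have mY0 : measurable_fun setT (fun p : R * T => Y 0%N p.2).
  exact: (measurableT_comp (mY 0%N) measurable_snd).
have mYv : measurable_fun setT (fun p : R * T => Y 0%N p.2 - p.1).
  by apply: measurable_funB => //; exact: measurable_fst.
have mt : measurable_fun setT (fun p : R * T => tail_tuple n Y p.2).
  exact: (measurableT_comp measurable_tail_tuple measurable_snd).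
have mf : measurable_fun setT
    (fun p : R * T => (Y 0%N p.2 - p.1, tail_tuple n Y p.2)).
  exact/measurable_fun_pair.
have -> : shifted B = ((fun p => p.1) @^-1` `[0, +oo[%classic `&`
    (fun p => Y 0%N p.2 - p.1) @^-1` `[0, +oo[%classic) `&`
    (fun p => (Y 0%N p.2 - p.1, tail_tuple n Y p.2)) @^-1` B.
  apply/seteqP; split => p /=; rewrite !in_itv/= !andbT subr_ge0.
    by move=> [].
  by move=> [[]].
apply: measurableI; first apply: measurableI.
- rewrite -[X in measurable X]setTI; apply: measurable_fst => //.
- rewrite -[X in measurable X]setTI; apply: mYv => //; exact: measurable_itv.
- by rewrite -[X in measurable X]setTI; exact: mf.
Qed.

Let ysection_shifted B t : measurable B -> lebesgueR (ysection (shifted B) t) =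
  lebesgueR [set w | [/\ 0 <= w, w <= Y 0%N t & B (w, tail_tuple n Y t)]].
Proof.
move=> mB.
have mA : measurable [set w | [/\ 0 <= w, w <= Y 0%N t & B (w, tail_tuple n Y t)]].
  rewrite (_ : [set w | _] = `[0, Y 0%N t]%classic `&` ysection B (tail_tuple n Y t)).
    by apply: measurableI; [exact: measurable_itv|exact: measurable_ysection].
  apply/seteqP; split => w /=; rewrite in_itv/= ysectionE/=.
    by move=> [-> ->].
  by move=> [/andP[]].
rewrite -[RHS](lebesgueR_reflect (Y 0%N t))//; congr lebesgueR.
rewrite ysectionE; apply/seteqP; split => v /=; rewrite /shifted/=.
  by move=> [v0 vY h]; split => //; [rewrite subr_ge0|rewrite lerBlDr lerDl].
by move=> [h1 h2 h3]; split => //; [rewrite lerBlDr lerDl in h2|rewrite -subr_ge0].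
Qed.

Let xsection_shifted B v : measurable B -> 0 <= v ->
  P (xsection (shifted B) v) =
  P [set t | v <= Z t /\ B (Y 0%N t, tail_tuple n Y t)].
Proof.
move=> mB v0; rewrite shift_identity//; congr (P _); rewrite xsectionE.
by apply/seteqP; split => t /=; rewrite /shifted/= => -[].
Qed.

Let mpair : measurable_fun setT (fun t => (Y 0%N t, tail_tuple n Y t)).
Proof. by apply/measurable_fun_pair => //; exact: measurable_tail_tuple. Qed.

Let mpreB (B : set (R * n.-tuple R)) : measurable B ->
  measurable [set t | B (Y 0%N t, tail_tuple n Y t)].
Proof. by move=> mB; rewrite -[X in measurable X]setTI; exact: mpair. Qed.

Lemma null_undergraph (B : set (R * n.-tuple R)) : measurable B ->
  P [set t | B (Y 0%N t, tail_tuple n Y t)] = 0%E ->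
  {ae P, forall t, lebesgueR
    [set w | [/\ 0 <= w, w <= Y 0%N t & B (w, tail_tuple n Y t)]] = 0%E}.
Proof.
move=> mB PB.
have mS := measurable_shifted mB.
have : (lebesgueR \x P)%E (shifted B) = 0%E.
  apply/(product_null_xsection _ _ mS); apply: aeW => v.
  have [v0|v0] := leP 0 v.
    rewrite [LHS]xsection_shifted//.
    apply: (subset_measure0 _ (mpreB mB)) => //; last by move=> t [].
    by apply: measurableI; [exact: measurable_ge_cst|exact: mpreB].
  rewrite (_ : xsection _ _ = set0) ?measure0//.
  apply/seteqP; split => t //=; rewrite xsectionE/= => -[/=].
  by rewrite leNgt v0.
move=> /(product_null_ysection _ _ mS).1.
by apply: filterS => t h; rewrite -ysection_shifted.
Qed.

(** Fubini gives that the event [v <= Z, (Y 0, V) \in B] is null for almost every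
    [v] only; but it decreases with [v], and [v] can be chosen arbitrarily
    small, while [Z] is almost surely positive. *)
Lemma undergraph_null (B : set (R * n.-tuple R)) : measurable B ->
  P [set t | Z t <= 0] = 0%E ->
  {ae P, forall t, lebesgueR
    [set w | [/\ 0 <= w, w <= Y 0%N t & B (w, tail_tuple n Y t)]] = 0%E} ->
  P [set t | B (Y 0%N t, tail_tuple n Y t)] = 0%E.
Proof.
move=> mB PZ hB.
have mS := measurable_shifted mB.
have : (lebesgueR \x P)%E (shifted B) = 0%E.
  apply/(product_null_ysection _ _ mS); apply: filterS hB => t h.
  by rewrite [LHS]ysection_shifted.
move=> /(product_null_xsection _ _ mS).1 [N [mN N0 hN]].
have mZB e : measurable [set t | e <= Z t /\ B (Y 0%N t, tail_tuple n Y t)].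
  by apply: measurableI; [exact: measurable_ge_cst|exact: mpreB].
have PZB e : 0 < e ->
    P [set t | e <= Z t /\ B (Y 0%N t, tail_tuple n Y t)] = 0%E.
  move=> e0.
  have [v [/andP[v0 ve] Nv]] : exists v, 0 <= v <= e /\ ~ N v.
    apply/not_existsP => h.
    have sub : `[0, e]%classic `<=` N.
      move=> v /=; rewrite in_itv/= => ve; apply: contrapT => Nv.
      by apply: (h v).
    have : lebesgueR `[0, e]%classic = 0%E.
      exact: (subset_measure0 (measurable_itv _) mN sub).
    rewrite /lebesgueR lebesgue_measure_itv/= lte_fin e0 sube0 => -[e0'].
    by rewrite e0' ltxx in e0.
  have PBv : P [set t | v <= Z t /\ B (Y 0%N t, tail_tuple n Y t)] = 0%E.
    by rewrite -xsection_shifted//; apply: contrapT => h; apply/Nv/hN.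
  apply: (subset_measure0 (mZB e) (mZB v) _ PBv).
  by move=> t [eZ ?]; split => //; exact: le_trans eZ.
have mZ0 : measurable [set t | Z t <= 0].
  rewrite (_ : [set t | _] = Z @^-1` `]-oo, 0]%classic).
    by rewrite -[X in measurable X]setTI; apply: mZ => //; exact: measurable_itv.
  by apply/seteqP; split => t /=; rewrite in_itv.
apply: (measure_negligible (mpreB mB)).
apply: (@negligibleS _ _ _ _ ([set t | Z t <= 0] `|` \bigcup_k
    [set t | k.+1%:R^-1 <= Z t /\ B (Y 0%N t, tail_tuple n Y t)])).
  move=> t /= Bt; have [Zt|Zt] := leP (Z t) 0; [by left|right].
  have [k _ hk] := @near_infty_natSinv_lt R (PosNum Zt).
  by exists k => //; split => //; apply/ltW/hk => /=.
apply: negligibleU; first exact/negligibleP.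
apply: negligible_bigcup => k; apply/negligibleP => //.
by apply: PZB; rewrite invr_gt0.
Qed.

(** [null_undergraph] for a set that only constrains [Y 0]. The conclusion is
    about all [c] because [Y 0] exceeds [c] with the positive probability
    [psi c]. *)
Lemma null_preimage (M : set R) (c : R) :
  (forall x y, x <= y -> psi y <= psi x) ->
  measurable M -> P [set t | M (psi (Y 0%N t))] = 0%E -> 0 <= c -> 0 < psi c ->
  lebesgueR [set w | [/\ 0 <= w, w <= c & M (psi w)]] = 0%E.
Proof.
move=> psi_ni mM PM c0 pc0.
have mpsi : measurable_fun setT psi.
  exact: nonincreasing_measurable.
have mpM : measurable (psi @^-1` M) by rewrite -[X in measurable X]setTI; exact: mpsi.
have mB : measurable ((psi @^-1` M) `*` [set: n.-tuple R]) by exact: measurableX.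
have PB : P [set t | ((psi @^-1` M) `*` [set: n.-tuple R])
    (Y 0%N t, tail_tuple n Y t)] = 0%E.
  by rewrite -[RHS]PM; congr (P _); apply/seteqP; split => t //= [].
have [N [mN N0 hN]] := null_undergraph mB PB.
have mYc : measurable [set t | c <= Y 0%N t] by exact: measurable_ge_cst.
have [t [ct Nt]] : exists t, c <= Y 0%N t /\ ~ N t.
  apply/not_existsP => h.
  have sub : [set t | c <= Y 0%N t] `<=` N.
    by move=> t ct; apply: contrapT => Nt; apply: (h t).
  have Pc0 : P [set t | c <= Y 0%N t] = 0%E.
    exact: (subset_measure0 mYc mN sub N0).
  pose y i := if i == 0%N then c else 0.
  have y0 i : 0 <= y i by rewrite /y; case: ifP.
  have := ZY (lexx 0) y0.
  have -> : 0 + \sum_(i < n.+1) y i = c.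
    by rewrite big_ord_recl/= /y/= big1// addr0 add0r.
  rewrite (_ : [set t | _] = [set t | c <= Y 0%N t]).
    by rewrite Pc0 => -[pc]; rewrite -pc ltxx in pc0.
  apply/seteqP; split => t /=; first by move=> [_ /(_ 0%N isT)].
  by move=> ct; split => // i _; rewrite /y; case: eqVneq => [->|].
have mA e : measurable [set w | [/\ 0 <= w, w <= e & M (psi w)]].
  rewrite (_ : [set w | _] = `[0, e]%classic `&` psi @^-1` M).
    by apply: measurableI => //; exact: measurable_itv.
  apply/seteqP; split => w /=; rewrite in_itv/=; first by move=> [-> ->].
  by move=> [/andP[]].
apply: (subset_measure0 (mA c) (mA (Y 0%N t))).
  by move=> w [w0 wc Mw]; split => //; exact: le_trans ct.
have : lebesgueR [set w | [/\ 0 <= w, w <= Y 0%N t &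
    (psi @^-1` M `*` [set: n.-tuple R]) (w, tail_tuple n Y t)]] = 0%E.
  by apply: contrapT => h; apply/Nt/hN.
move=> <-; congr lebesgueR; apply/seteqP; split => w /=.
  by move=> [].
by move=> [? ? []].
Qed.

End shift.

(** By induction the tail [V] avoids the Lebesgue-null set of those [u] over
    which the section of [A] is not null. Over the other [u] the section pulls
    back through [psi] to a null set below [Y 0], and [undergraph_null]
    applies. *)
Theorem joint_survival_abs_continuous (n : nat) (Z : T -> R) (Y : nat -> T -> R) :
  measurable_fun setT Z -> (forall i, measurable_fun setT (Y i)) ->
  (forall t, 0 <= Z t) -> (forall i t, 0 <= Y i t) ->
  (forall x y, x <= y -> psi y <= psi x) ->
  (forall i t, 0 < psi (Y i t)) ->
  P [set t | Z t <= 0] = 0%E ->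
  (forall i (M : set R), (i < n)%N -> measurable M -> lebesgueR M = 0%E ->
    P [set t | M (psi (Y i t))] = 0%E) ->
  joint_survival n Z Y ->
  forall A : set (n.-tuple R), measurable A -> lebesgue_tuple n A = 0%E ->
  P [set t | A [tuple psi (Y i t) | i < n]] = 0%E.
Proof.
move=> mZ + Z0 + psi_ni + PZ; elim: n Y => [|n IH] Y mY Y0 pY PY ZY A mA A0.
  rewrite (_ : [set t | _] = set0) ?measure0//.
  apply/seteqP; split => t //=.
  have -> : [tuple psi (Y i t) | i < 0] = [tuple] by apply: eq_from_tnth => -[].
  move=> At; move: A0; rewrite /= diracE mem_set// => -[].
  by move/eqP; rewrite oner_eq0.
have mpsi : measurable_fun setT psi.
  exact: nonincreasing_measurable.
have ZY' : joint_survival n Z (fun i => Y i.+1).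
  move=> z y z0 y0.
  pose y' i := if i is j.+1 then y j else 0.
  have y'0 i : 0 <= y' i by case: i => [//|i]; exact: y0.
  have := ZY z y' z0 y'0.
  rewrite big_ord_recl/= add0r => <-.
  congr (P _); apply/seteqP; split => t /= [zZ h]; split => //.
    by case=> [|i] //=; rewrite ltnS; exact: h.
  by move=> i; exact: (h i.+1).
have mA' := measurable_tuple_of_pair_preimage mA.
move: A0; rewrite lebesgue_tuple_consE => /(product_null_ysection _ _ mA').1.
move=> [Q [mQ Q0 hQ]].
have PQ : P [set t | Q [tuple psi (Y i.+1 t) | i < n]] = 0%E.
  apply: (IH (fun i => Y i.+1)) => // i M ni; exact: PY.
(* The set [A] in the scale of [Y] is [B]. *)
pose h (p : R * n.-tuple R) : R * n.-tuple R :=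
  (psi p.1, [tuple psi (tnth p.2 i) | i < n]).
have mh : measurable_fun setT h.
  apply/measurable_fun_pair.
    exact: (measurableT_comp mpsi measurable_fst).
  apply: measurable_mktuple => i; apply: measurableT_comp => //.
  exact: (measurableT_comp (measurable_tnth i) measurable_snd).
pose B := h @^-1` (@tuple_of_pair R n @^-1` A).
have mB : measurable B by rewrite -[X in measurable X]setTI; exact: mh.
have hE w t : h (w, tail_tuple n Y t) = (psi w, [tuple psi (Y i.+1 t) | i < n]).
  congr pair; apply: eq_from_tnth => i.
  by rewrite !tnth_mktuple.
have AE : [set t | A [tuple psi (Y i t) | i < n.+1]] =
    [set t | B (Y 0%N t, tail_tuple n Y t)].
  apply/funext => t; rewrite /= /B /= hE; congr A.
  apply: eq_from_tnth => i; rewrite tnth_mktuple.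
  case: (unliftP ord0 i) => [j ->|->]; last by [].
  by rewrite tnthS tnth_mktuple.
rewrite AE; apply: (undergraph_null mZ mY Z0 Y0 ZY) => //.
exists [set t | Q [tuple psi (Y i.+1 t) | i < n]]; split => //.
  rewrite -[X in measurable X]setTI.
  have mt : measurable_fun setT (fun t => [tuple psi (Y i.+1 t) | i < n]).
    by apply: measurable_mktuple => i; exact: measurableT_comp.
  exact: mt.
move=> t /= nt; apply: contrapT => Qt; apply: nt.
set u := [tuple psi (Y i.+1 t) | i < n] in Qt.
pose M := ysection (@tuple_of_pair R n @^-1` A) u.
have mM : measurable M by exact: measurable_ysection.
have M0 : lebesgueR M = 0%E by apply: contrapT => M0; apply/Qt/hQ.
rewrite (_ : [set w | _] = [set w | [/\ 0 <= w, w <= Y 0%N t & M (psi w)]]).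
  by apply: (null_preimage mZ mY Z0 Y0 ZY) => //; exact: PY.
apply/seteqP; split => w /= [w0 wY]; rewrite /B /= hE /M ysectionE; by split.
Qed.

End exchange.

(** * The inverse of a generator and the law of a copula *)

Section generator_inverse.
Context {R : realType} (psi : R -> R).
Hypothesis hpsi : generator psi.

(** The strict decrease is only given up to the first zero of [psi]; past it
    [psi] vanishes, which [0 < psi z] excludes. *)
Lemma gen_pos_inj (y z : R) : 0 <= y -> y < z -> 0 < psi z -> psi z < psi y.
Proof.
move=> y0 yz pz.
have [zi|iz] := leP z%:E (gen_inv psi 0).
  by apply: (gen_decreasing hpsi (y := y%:E) (z := z%:E)).
have [w [w0 pw] wz] := ereal_inf_lt iz.
case: w => [r| |] // in w0 pw wz *.
rewrite lte_fin in wz; have {}w0 : 0 <= r by rewrite -lee_fin.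
have := gen_nonincreasing hpsi w0 (ltW wz).
by move: pw => /= ->; rewrite leNgt pz.
Qed.

Lemma gen_inv_psi (z : R) : 0 <= z -> 0 < psi z -> gen_inv psi (psi z) = z%:E.
Proof.
move=> z0 pz; rewrite /gen_inv (_ : [set w | _] = [set z%:E]) ?ereal_inf1//.
apply/seteqP; split => [[r| |] //= [r0]|_ ->]; last by rewrite /= lee_fin.
  have {}r0 : 0 <= r by rewrite -lee_fin.
  move=> e; congr EFin.
  have [rz|zr|//] := ltgtP r z.
    by have := gen_pos_inj r0 rz pz; rewrite e ltxx.
  by have := gen_pos_inj z0 zr; rewrite e pz => /(_ isT); rewrite ltxx.
  by move=> e; rewrite -e ltxx in pz.
by rewrite leeNy_eq in r0.
Qed.

Lemma gen_surj (x : R) : 0 < x <= 1 -> exists2 z, 0 <= z & psi z = x.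
Proof.
move=> /andP[x0 x1].
have [M [M0 pM]] : exists M, 0 <= M /\ psi M < x.
  have h : \forall z \near +oo, psi z < x by apply: cvgr_lt (gen_lim hpsi) _ x0.
  near (+oo : set_system R) => M; exists M; split.
    by near: M; exact: nbhs_pinfty_ge.
  by near: M.
have cpsi : {within `[0, M], continuous psi}.
  apply: continuous_subspaceW (gen_continuous hpsi) => r /=.
  by rewrite !in_itv/= => /andP[->].
have pM1 : psi M <= psi 0 by exact: gen_nonincreasing.
have xM : Num.min (psi 0) (psi M) <= x <= Num.max (psi 0) (psi M).
  by rewrite (min_r pM1) (max_l pM1) (ltW pM) (gen_at0 hpsi).
have [c cM pc] := IVT M0 cpsi xM.
by exists c => //; move: cM; rewrite in_itv/= => /andP[].
Unshelve. all: by end_near. Qed.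

(** A real-valued version of the inverse, with the default value [0] off
    the interval where the inverse is finite, so that it is nonnegative and
    [psi] is positive at it everywhere. *)
Definition gen_phi (x : R) : R := if 0 < x <= 1 then fine (gen_inv psi x) else 0.

Lemma gen_phiP (x : R) : 0 < x <= 1 -> 0 <= gen_phi x /\ psi (gen_phi x) = x.
Proof.
move=> x01; rewrite /gen_phi x01; have [z z0 zx] := gen_surj x01.
have pz : 0 < psi z by rewrite zx; case/andP: x01.
by rewrite -zx gen_inv_psi.
Qed.

Lemma gen_phi_ge0 x : 0 <= gen_phi x.
Proof.
have [x01|nx] := boolP (0 < x <= 1); first by case: (gen_phiP x01).
by rewrite /gen_phi (negbTE nx).
Qed.

Lemma gen_phi_geE (x y : R) : 0 < x <= 1 -> 0 <= y ->
  (y <= gen_phi x) = (x <= psi y).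
Proof.
move=> x01 y0; have [p0 px] := gen_phiP x01.
apply/idP/idP => h; first by rewrite -px; exact: gen_nonincreasing.
rewrite leNgt; apply/negP => py.
have py0 : 0 < psi y by case/andP: x01 => x0 _; exact: lt_le_trans h.
by have := gen_pos_inj p0 py py0; rewrite px ltNge h.
Qed.

Lemma measurable_gen_phi : measurable_fun setT gen_phi.
Proof.
apply: (measurability _ (RGenCInfty.measurableE R)).
move=> _ [_ [a ->] <-]; rewrite setTI.
have [a0|a0] := leP a 0.
  rewrite (_ : _ @^-1` _ = setT); first exact: measurableT.
  apply/seteqP; split => x //= _; rewrite in_itv/= andbT.
  exact: le_trans (gen_phi_ge0 x).
rewrite (_ : _ @^-1` _ = `]0, psi a]%classic); first exact: measurable_itv.
have /andP[_ pa1] := gen_range hpsi (ltW a0).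
apply/seteqP; split => x /=; rewrite !in_itv/= andbT.
  have [x01|nx] := boolP (0 < x <= 1).
    by rewrite (gen_phi_geE x01 (ltW a0)); case/andP: x01 => ->.
  by rewrite /gen_phi (negbTE nx) leNgt a0.
move=> /andP[x0 xa]; have x01 : 0 < x <= 1 by rewrite x0 (le_trans xa).
by rewrite (gen_phi_geE x01 (ltW a0)).
Qed.

(** Only the values of [psi] on the nonnegative reals are specified; this
    extension is monotone, hence measurable, on the whole line. *)
Definition gen_total (x : R) : R := psi (Num.max 0 x).

Lemma gen_totalE x : 0 <= x -> gen_total x = psi x.
Proof. by move=> x0; rewrite /gen_total max_r. Qed.

Lemma gen_total_nonincreasing x y : x <= y -> gen_total y <= gen_total x.
Proof.
move=> xy; apply: (gen_nonincreasing hpsi); first by rewrite le_max lexx.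
by rewrite ge_max !le_max lexx/= xy orbT.
Qed.

Lemma gen_total_phi x : 0 < x <= 1 -> gen_total (gen_phi x) = x.
Proof. by move=> x01; have [p0 px] := gen_phiP x01; rewrite gen_totalE. Qed.

Lemma gen_total_phi_gt0 x : 0 < gen_total (gen_phi x).
Proof.
have [x01|nx] := boolP (0 < x <= 1).
  by rewrite gen_total_phi//; case/andP: x01.
by rewrite /gen_phi (negbTE nx) gen_totalE// (gen_at0 hpsi).
Qed.

End generator_inverse.

Section eq_off_null.
Context d (T : measurableType d) (R : realType) (P : {measure set T -> \bar R}).

Lemma eq_measure_off_null (N A B : set T) :
  measurable N -> measurable A -> measurable B -> P N = 0%E ->
  (forall t, ~ N t -> A t <-> B t) -> P A = P B.
Proof.
move=> mN mA mB N0 AB.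
have off C : measurable C -> P C = P (C `\` N).
  move=> mC; rewrite (measureDI P mC mN).
  by rewrite (subset_measure0 (measurableI _ _ mC mN) mN _ N0) ?adde0.
rewrite off// [RHS]off//; congr (P _); apply/seteqP; split => t /= [Ct nN].
  by split => //; apply/(AB _ nN).
by split => //; apply/(AB _ nN).
Qed.

End eq_off_null.

Section copula_law.
Context {R : realType} (d : nat) (C : d.-tuple R -> R).
Variable muC : probability (d.-tuple R) R.
Hypotheses (hC : is_copula C) (hmuC : induced_measure C muC).
Hypothesis d0 : (0 < d)%N.

Let ones : d.-tuple R := [tuple 1 | i < d].

Let cube_ones : cube ones.
Proof. by move=> i; rewrite tnth_mktuple ler01 lexx. Qed.

Lemma law_cube : muC (@cube R d) = 1%E.
Proof.
have -> : @cube R d = box0 ones.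
  by apply/seteqP; split => z /= h i; have := h i; rewrite tnth_mktuple.
rewrite hmuC//; congr EFin.
rewrite (copula_uniform hC (i := Ordinal d0))//; first by rewrite tnth_mktuple.
by move=> j _; rewrite tnth_mktuple.
Qed.

Lemma law_cubeC : muC (~` @cube R d) = 0%E.
Proof. by rewrite probability_setC ?law_cube ?subee//; exact: measurable_cube. Qed.

Definition pos_cube : set (d.-tuple R) := [set z | forall i, 0 < tnth z i <= 1].

Lemma measurable_coord_le (i : 'I_d) (c : R) :
  measurable [set z : d.-tuple R | tnth z i <= c].
Proof.
rewrite (_ : [set z | _] = (fun z : d.-tuple R => tnth z i) @^-1` `]-oo, c]%classic).
  rewrite -[X in measurable X]setTI.
  by apply: measurable_tnth => //; exact: measurable_itv.
by apply/seteqP; split => z /=; rewrite in_itv.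
Qed.

Lemma measurable_pos_cube : measurable pos_cube.
Proof.
rewrite (_ : pos_cube = \bigcap_(i in [set: 'I_d])
    ((fun z => tnth z i) @^-1` `]0, 1]%classic)).
  apply: fin_bigcap_measurable; first exact: finite_finset.
  move=> i _; rewrite -[X in measurable X]setTI.
  by apply: measurable_tnth => //; exact: measurable_itv.
apply/seteqP; split => z /= h i; first by move=> _; rewrite /= in_itv; exact: h.
by have := h i Logic.I; rewrite /= in_itv.
Qed.

Lemma law_box0 (x : d.-tuple R) : cube x ->
  measurable [set z : d.-tuple R | forall i, tnth z i <= tnth x i] /\
  muC [set z | forall i, tnth z i <= tnth x i] = (C x)%:E.
Proof.
move=> cx.
have mB : measurable [set z : d.-tuple R | forall i, tnth z i <= tnth x i].
  rewrite (_ : [set z | _] = \bigcap_(i in [set: 'I_d])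
    [set z : d.-tuple R | tnth z i <= tnth x i]).
    apply: fin_bigcap_measurable; first exact: finite_finset.
    by move=> i _; exact: measurable_coord_le.
  apply/seteqP; split => z /= h i; first by move=> _; exact: h.
  exact: (h i Logic.I).
split => //; rewrite -hmuC//.
have boxE : box0 x = [set z | forall i, tnth z i <= tnth x i] `&` @cube R d.
  apply/seteqP; split => z /=.
    move=> h; split => i; have /andP[z0 zx] := h i => //.
    by rewrite z0 (le_trans zx)//; case/andP: (cx i).
  by move=> [h c] i; rewrite h andbT; case/andP: (c i).
apply: (@eq_measure_off_null _ _ _ _ (~` @cube R d)) => //.
- by apply: measurableC; exact: measurable_cube.
- by rewrite boxE; apply: measurableI => //; exact: measurable_cube.
- exact: law_cubeC.
- by move=> z /contrapT cz; rewrite boxE; split => [//|[]].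
Qed.

(** A coordinate vanishes with probability [0] because [C] is grounded. *)
Lemma law_pos_cubeC : muC (~` pos_cube) = 0%E.
Proof.
have mP := measurableC measurable_pos_cube.
apply: (measure_negligible mP).
apply: (@negligibleS _ _ _ _ (~` @cube R d `|` \big[setU/set0]_(i < d)
    [set z : d.-tuple R | tnth z i <= 0])).
  move=> z /= nz; rewrite -bigcup_seq/=.
  have [cz|] := pselect (cube z); [right|by left].
  apply: contrapT => h; apply: nz => i; have /andP[zi0 zi1] := cz i.
  rewrite zi1 andbT lt_neqAle zi0 andbT; apply/eqP => zi.
  by apply: h; exists i => //=; rewrite ?mem_index_enum// -zi.
apply: negligibleU.
  apply/negligibleP; first by apply: measurableC; exact: measurable_cube.
  exact: law_cubeC.
elim/big_ind : _ => [|A B|i _].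
- exact: negligible_set0.
- exact: negligibleU.
apply/negligibleP; first exact: measurable_coord_le.
pose x : d.-tuple R := [tuple if j == i then 0 else 1 | j < d].
have cx : cube x.
  by move=> j; rewrite tnth_mktuple; case: ifP => _; rewrite ?lexx ler01.
have [mx ex] := law_box0 cx.
have xi : tnth x i = 0 by rewrite tnth_mktuple eqxx.
rewrite -[RHS](_ : (C x)%:E = 0%E); last by rewrite (copula_grounded hC cx xi).
rewrite -ex.
apply: (@eq_measure_off_null _ _ _ _ (~` @cube R d)) => //.
- by apply: measurableC; exact: measurable_cube.
- exact: measurable_coord_le.
- exact: law_cubeC.
- move=> z /contrapT cz; split => /= h.
    move=> j; rewrite tnth_mktuple; case: eqVneq => [->//|_].
    by case/andP: (cz j).
  by have := h i; rewrite xi.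
Qed.

Lemma law_coord_le (i : 'I_d) (a : R) : 0 <= a <= 1 ->
  muC [set z : d.-tuple R | tnth z i <= a] = a%:E.
Proof.
move=> /andP[a0 a1].
pose x : d.-tuple R := [tuple if j == i then a else 1 | j < d].
have cx : cube x.
  by move=> j; rewrite tnth_mktuple; case: ifP => _; rewrite ?a0 ?a1 ?lexx ?ler01.
have [mx ex] := law_box0 cx.
have xi : tnth x i = a by rewrite tnth_mktuple eqxx.
rewrite -{2}xi -(copula_uniform hC cx (i := i)); last first.
  by move=> j ji; rewrite tnth_mktuple (negbTE ji).
rewrite -ex.
apply: (@eq_measure_off_null _ _ _ _ (~` @cube R d)) => //.
- by apply: measurableC; exact: measurable_cube.
- exact: measurable_coord_le.
- exact: law_cubeC.
- move=> z /contrapT cz; split => /= h.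
    move=> j; rewrite tnth_mktuple; case: eqVneq => [->//|_].
    by case/andP: (cz j).
  by have := h i; rewrite xi.
Qed.

(** The uniform margins of [C] in terms of all Borel sets. *)
Lemma law_coord (i : 'I_d) (M : set R) : measurable M ->
  muC [set z | M (tnth z i)] = lebesgueR (M `&` `[0, 1]%classic).
Proof.
move=> mM.
have mti : measurable_fun setT (fun z : d.-tuple R => tnth z i).
  exact: measurable_tnth.
pose m1 := measure_function_pushforward__canonical__measure_function_Measure
  muC mti.
have m01 : measurable `[0, 1 : R]%classic by exact: measurable_itv.
pose m2 : {measure set R -> \bar R} := mrestr lebesgueR m01.
have lebE (J : interval R) : lebesgueR [set` J] = lebesgue_measure [set` J] by [].
pose G : set (set R) := [set A | exists x, A = `]x, +oo[%classic].
pose g k : set R := `](- k%:R), +oo[%classic.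
suff : forall A, measurable A -> m1 A = m2 A by exact.
apply: (measure_unique G g) => //.
- exact: RGenOInfty.measurableE.
- move=> _ _ [x ->] [y ->]; exists (Num.max x y).
  by apply/seteqP; split => z /=; rewrite !in_itv/= !andbT gt_max;
    [move=> [-> ->]|move=> /andP[]].
- by move=> k; exists (- k%:R).
- apply/seteqP; split => // z _; exists (Num.bound `|z|) => //.
  rewrite /g /= in_itv/= andbT ltrNl (le_lt_trans (ler_norm _))// normrN.
  exact: archi_boundP.
- move=> _ [x ->].
  have mx : measurable `]x, +oo[%classic by exact: measurable_itv.
  have -> : m1 `]x, +oo[%classic = (1 - muC [set z : d.-tuple R | (tnth z i <= x)%R])%E.
    rewrite -probability_setC; last exact: measurable_coord_le.
    congr (muC _); apply/seteqP; split => z /=; rewrite in_itv/= andbT ltNge.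
      by move/negP.
    by move/negP.
  have [x0|x0] := ltP x 0.
    have h0 : muC [set z : d.-tuple R | tnth z i <= 0] = 0%E.
      by rewrite law_coord_le ?lexx ?ler01.
    have -> : muC [set z : d.-tuple R | (tnth z i <= x)%R] = 0%E.
      apply: (subset_measure0 (measurable_coord_le i x)
        (measurable_coord_le i 0) _ h0).
      by move=> z /= /le_trans; apply; exact: ltW.
    rewrite sube0 /m2 /= /mrestr (_ : _ `&` _ = `[0, 1]%classic).
      by rewrite lebE lebesgue_measure_itv/= lte_fin ltr01 sube0.
    apply/seteqP; split => z /=; rewrite !in_itv/= andbT; first by case.
    by move=> /andP[z0 ->]; rewrite z0 (lt_le_trans x0 z0).
  have [x1|x1] := ltP x 1; last first.
    have -> : muC [set z : d.-tuple R | (tnth z i <= x)%R] = 1%E.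
      apply/eqP; rewrite eq_le probability_le1/=; last exact: measurable_coord_le.
      rewrite -[leLHS](law_coord_le i (a := 1)) ?ler01 ?lexx//.
      apply: le_measure; rewrite ?inE; try exact: measurable_coord_le.
      by move=> z /= /le_trans; apply.
    rewrite subee// /m2 /= /mrestr (_ : _ `&` _ = set0) ?measure0//.
    apply/seteqP; split => z //=; rewrite !in_itv/= andbT => -[xz /andP[_ z1]].
    by have := lt_le_trans xz z1; rewrite ltNge x1.
  rewrite law_coord_le ?x0 ?ltW//.
  rewrite /m2 /= /mrestr (_ : _ `&` _ = `]x, 1]%classic).
    by rewrite lebE lebesgue_measure_itv/= lte_fin x1.
  apply/seteqP; split => z /=; rewrite !in_itv/= andbT.
    by move=> [-> /andP[_]].
  by move=> /andP[xz ->]; rewrite xz (ltW (le_lt_trans x0 xz)).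
- move=> k; apply: (@le_lt_trans _ _ 1%E); last exact: ltry.
  apply: probability_le1; rewrite -[X in measurable X]setTI.
  exact: (mti measurableT _ (measurable_itv _)).
Qed.

End copula_law.

(** * Absolute continuity of the initial blocks *)

Section archimedean_law.
Context {R : realType} (d : nat) (C : d.-tuple R -> R) (psi : R -> R).
Variable muC : probability (d.-tuple R) R.
Hypotheses (hC : is_copula C) (hmuC : induced_measure C muC).
Hypothesis hpsi : generator psi.
Hypothesis Cpsi : forall x : d.-tuple R, cube x ->
  C x = gen_ext psi (\sum_(i < d) gen_inv psi (tnth x i))%E.

Let phi_coord (i : nat) (z : d.-tuple R) : R := gen_phi psi (nth 0 z i).

Let measurable_phi_coord i : measurable_fun setT (phi_coord i).
Proof.
apply: measurableT_comp; first exact: measurable_gen_phi.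
exact: measurable_nth.
Qed.

(** On the cube without its lower faces the event is a box with upper corner
    [psi (y i)] for [i < l], [psi z0] for [i = l] and [1] beyond, whose mass is a
    value of [C]. When a corner coordinate is [0] the inverse is not [y i], and
    both sides vanish instead. *)
Lemma archimedean_joint_survival (l : nat) : (l < d)%N ->
  joint_survival muC (gen_total psi) l (phi_coord l) phi_coord.
Proof.
move=> ld z0 y z00 y0.
have d0 : (0 < d)%N by exact: leq_ltn_trans ld.
have psi01 := gen_range hpsi.
pose f (i : nat) := if (i < l)%N then psi (y i) else if i == l then psi z0 else 1.
pose g (i : nat) := if (i < l)%N then y i else if i == l then z0 else 0.
have g0 i : 0 <= g i by rewrite /g; case: ifP => // _; case: ifP.
have fg i : f i = psi (g i).
  by rewrite /f /g; case: ifP => // _; case: ifP => // _; rewrite (gen_at0 hpsi).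
pose x : d.-tuple R := [tuple f i | i < d].
have cx : cube x by move=> i; rewrite tnth_mktuple fg; exact: psi01.
have [mB BE] := law_box0 hC hmuC d0 cx.
have sumg : \sum_(i < d) g i = z0 + \sum_(i < l) y i.
  rewrite -(big_mkord xpredT g) (big_cat_nat (n := l))//=; last exact: ltnW.
  rewrite [X in _ + X]big_ltn// {2}/g ltnn eqxx.
  rewrite [X in _ + (_ + X)]big_nat_cond [X in _ + (_ + X)]big1; last first.
    move=> i /andP[/andP[li _] _]; rewrite /g ltnNge (ltnW li)/=.
    by rewrite gtn_eqF.
  rewrite addr0 addrC; congr (_ + _).
  by rewrite big_mkord; apply: eq_bigr => i _; rewrite /g ltn_ord.
have sumy0 : 0 <= \sum_(i < l) y i by apply: sumr_ge0.
have tot0 : 0 <= z0 + \sum_(i < l) y i by exact: addr_ge0.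
have -> : gen_total psi (z0 + \sum_(i < l) y i) = C x.
  rewrite gen_totalE//.
  have [[i fi]|allpos] := pselect (exists i : 'I_d, f i = 0).
    have xi : tnth x i = 0 by rewrite tnth_mktuple.
    rewrite (copula_grounded hC cx xi); apply/eqP.
    rewrite eq_le; have /andP[-> _] := psi01 _ tot0; rewrite andbT.
    rewrite -[leRHS]fi fg; apply: (gen_nonincreasing hpsi) => //.
    by rewrite -sumg (bigD1 i)//= lerDl; apply: sumr_ge0.
  rewrite Cpsi// -sumg.
  rewrite (eq_bigr (fun i : 'I_d => (g i)%:E)) ?sumEFin// => i _.
  rewrite tnth_mktuple fg gen_inv_psi// -fg lt_neqAle.
  have /andP[f0 _] := psi01 _ (g0 i); rewrite -fg in f0; rewrite f0 andbT.
  by apply/eqP => h; apply: allpos; exists i.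
rewrite -BE; apply: (@eq_measure_off_null _ _ _ _ (~` @pos_cube R d)) => //.
- by apply: measurableC; exact: measurable_pos_cube.
- apply: measurableI; first exact: measurable_ge_cst.
  rewrite [X in measurable X](_ : _ = \bigcap_i
    [set t | (i < l)%N -> y i <= phi_coord i t]); last first.
    by apply/seteqP; split => t /= h i; [move=> _; exact: h|exact: (h i Logic.I)].
  apply: bigcapT_measurable => i; case: (ltnP i l) => il.
    rewrite (_ : [set t | _] = [set t | y i <= phi_coord i t]).
      exact: measurable_ge_cst.
    by apply/seteqP; split => t /=; [exact|move=> + _].
  rewrite (_ : [set t | _] = setT); first exact: measurableT.
  by apply/seteqP; split.
- exact: law_pos_cubeC hC hmuC d0.
- move=> t /contrapT pt.
  have ptn i : (i < d)%N -> 0 < nth 0 t i <= 1.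
    by move=> id; have := pt (Ordinal id); rewrite (tnth_nth 0).
  split => /=.
    move=> [zt yt] i; rewrite tnth_mktuple (tnth_nth 0) /f.
    have pti := ptn i (ltn_ord i).
    case: ifP => il; first by rewrite -(gen_phi_geE hpsi)//; exact: yt.
    case: eqVneq => [il'|_]; last by case/andP: pti.
    by rewrite -(gen_phi_geE hpsi)// il'.
  move=> h; have hn i : (i < d)%N -> nth 0 t i <= f i.
    by move=> id; have := h (Ordinal id); rewrite tnth_mktuple (tnth_nth 0).
  split.
    rewrite (gen_phi_geE hpsi)//; last exact: ptn.
    by have := hn l ld; rewrite /f ltnn eqxx.
  move=> i il; have id := ltn_trans il ld.
  rewrite (gen_phi_geE hpsi)//; last exact: ptn.
  by have := hn i id; rewrite /f il.
Qed.

(** The coordinate [l], which exists because [l < d], serves as the spare one. *)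
Lemma init_block_abs_continuous (l : nat) (A : set (l.-tuple R)) : (l < d)%N ->
  measurable A -> lebesgue_tuple l A = 0%E ->
  muC [set z | A (init_block l z)] = 0%E.
Proof.
move=> ld mA A0.
have d0 : (0 < d)%N by exact: leq_ltn_trans ld.
have mC := measurableC (@measurable_pos_cube R d).
have C0 : muC (~` @pos_cube R d) = 0%E by exact: law_pos_cubeC hC hmuC d0.
have mpsi : measurable_fun setT (gen_total psi).
  apply: nonincreasing_measurable => // x y.
  exact: gen_total_nonincreasing.
have ptn (t : d.-tuple R) i : pos_cube t -> (i < d)%N -> 0 < nth 0 t i <= 1.
  by move=> pt id; have := pt (Ordinal id); rewrite (tnth_nth 0).
have coord0 i (M : set R) : (i < d)%N -> measurable M ->
    lebesgueR (M `&` `[0, 1]%classic) = 0%E ->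
    muC [set t | M (nth 0 t i)] = 0%E.
  move=> id mM M0; rewrite -[RHS]M0 -(law_coord hC hmuC d0 (Ordinal id) mM).
  by congr (muC _); apply/seteqP; split => t /=; rewrite (tnth_nth 0).
have mcoord i (M : set R) : measurable M ->
    measurable [set t : d.-tuple R | M (nth 0 t i)].
  by move=> mM; rewrite -[X in measurable X]setTI; exact: measurable_nth.
have := joint_survival_abs_continuous (measurable_phi_coord l) measurable_phi_coord
  (fun t => gen_phi_ge0 hpsi _) (fun i t => gen_phi_ge0 hpsi _)
  (fun x y => @gen_total_nonincreasing R psi hpsi x y)
  (fun i t => gen_total_phi_gt0 hpsi _) _ _ (archimedean_joint_survival ld) mA A0.
move=> h; rewrite -[RHS]h.
- apply: (@eq_measure_off_null _ _ _ _ (~` @pos_cube R d)) => //.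
  + rewrite -[X in measurable X]setTI; exact: measurable_init_block.
  + rewrite -[X in measurable X]setTI.
    have mt : measurable_fun setT
        (fun t => [tuple gen_total psi (phi_coord i t) | i < l]).
      by apply: measurable_mktuple => i; exact: measurableT_comp.
    exact: mt.
  + move=> t /contrapT pt.
    rewrite /= (_ : [tuple _ | i < l] = init_block l t)//.
    apply: eq_from_tnth => i; rewrite !tnth_mktuple gen_total_phi//.
    by apply: ptn => //; exact: ltn_trans ld.
- apply: (measure_negligible _) => /=.
    rewrite (_ : [set t | _] = (phi_coord l) @^-1` `]-oo, 0]%classic).
      rewrite -[X in measurable X]setTI.
      by apply: measurable_phi_coord => //; exact: measurable_itv.
    by apply/seteqP; split => t /=; rewrite in_itv.
  apply: (@negligibleS _ _ _ _
    (~` @pos_cube R d `|` [set t | [set 1] (nth 0 t l)])).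
    move=> t /= pl; have [pt|] := pselect (pos_cube t); [right|by left].
    have [p0 pe] := gen_phiP hpsi (ptn t l pt ld).
    rewrite -pe (_ : gen_phi psi _ = 0) ?(gen_at0 hpsi)//.
    by apply/eqP; rewrite eq_le p0 andbT.
  apply: negligibleU; first exact/negligibleP.
  apply/negligibleP; first exact: mcoord.
  apply: coord0 => //.
  apply: (subset_measure0 _ (measurable_set1 1)) => //.
    by apply: measurableI => //; exact: measurable_itv.
  exact: lebesgue_measure_set1.
- move=> i M il mM M0.
  have id := ltn_trans il ld.
  apply: measure_negligible.
    rewrite -[X in measurable X]setTI.
    have mc : measurable_fun setT (fun t => gen_total psi (phi_coord i t)).
      exact: measurableT_comp.
    exact: mc.
  apply: (@negligibleS _ _ _ _
    (~` @pos_cube R d `|` [set t | M (nth 0 t i)])).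
    move=> t /= Mt; have [pt|] := pselect (pos_cube t); [right|by left].
    by rewrite gen_total_phi// in Mt; exact: ptn.
  apply: negligibleU; first exact/negligibleP.
  apply/negligibleP; first exact: mcoord.
  apply: coord0 => //.
  apply: (subset_measure0 _ mM) => //.
    by apply: measurableI => //; exact: measurable_itv.
Qed.

End archimedean_law.

(** * From blocks to the cube *)

Section cube_measure.
Context {R : realType}.
Local Open Scope ereal_scope.

Lemma lebesgue_tuple_cube (n : nat) : lebesgue_tuple n (@cube R n) = 1.
Proof.
elim: n => [|n IH]; first by rewrite /= diracE mem_set// => -[].
rewrite lebesgue_tuple_consE.
rewrite (_ : _ @^-1` _ = `[0%R, 1%R]%classic `*` @cube R n); last first.
  apply/seteqP; split => -[a t] /=; rewrite in_itv/=.
    move=> h; split; first exact: (h ord0).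
    by move=> i; have := h (lift ord0 i); rewrite tnthS.
  move=> [a01 ct] i; case: (unliftP ord0 i) => [j ->|->]; last exact: a01.
  by rewrite tnthS; exact: ct.
rewrite [LHS]product_measure1E//; last exact: measurable_cube.
rewrite IH mule1; transitivity (lebesgue_measure `[0%R, 1%R : R]%classic) => //.
by rewrite lebesgue_measure_itv/= lte_fin ltr01 sube0.
Qed.

HB.instance Definition _ (n : nat) := Measure.copy (@lebesgue_cube R n)
  (mrestr (lebesgue_tuple n) (@measurable_cube R n)).

Lemma lebesgue_cube_fin (n : nat) : fin_num_fun (@lebesgue_cube R n).
Proof.
apply: lty_fin_num_fun.
rewrite -[ltLHS]/(lebesgue_tuple n (setT `&` @cube R n)) setTI.
by rewrite lebesgue_tuple_cube ltry.
Qed.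

HB.instance Definition _ (n : nat) := @Measure_isFinite.Build _ _ _
  (@lebesgue_cube R n) (@lebesgue_cube_fin n).

End cube_measure.

Section ae_full.
Context d (T : measurableType d) (R : realType) (nu : probability T R).

Lemma ae_fullP (P : T -> Prop) (D : set T) : measurable D -> nu D = 1%E ->
  {ae nu, forall x, P x} <->
  exists L, [/\ measurable L, L `<=` D, nu L = 1%E & forall x, L x -> P x].
Proof.
move=> mD D1; split => [[N [mN N0 hN]]|[L [mL LD L1 LP]]].
  have mL : measurable (D `\` N) by exact: measurableD.
  exists (D `\` N); split => //.
  - rewrite -[RHS]D1; apply: (@eq_measure_off_null _ _ _ _ N) => //.
    by move=> x Nx; split => [[]|Dx].
  - by move=> x [_ Nx]; apply: contrapT => h; apply/Nx/hN.
exists (~` L); split.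
- exact: measurableC.
- by rewrite probability_setC// L1 subee.
- by move=> x nP /LP.
Qed.

End ae_full.

Section block_law.
Context {R : realType} (d l : nat) (muC : probability (d.-tuple R) R).
Hypothesis ld : (l <= d)%N.

Definition blocks (z : d.-tuple R) : l.-tuple R * (d - l).-tuple R :=
  (init_block l z, tail_block l z).

Lemma measurable_blocks : measurable_fun setT blocks.
Proof.
by apply/measurable_fun_pair; [exact: measurable_init_block|exact: measurable_tail_block].
Qed.

Definition block_law : set (l.-tuple R * (d - l).-tuple R) -> \bar R :=
  pushforward muC blocks.

HB.instance Definition _ := Measure.copy block_law
  (measure_function_pushforward__canonical__measure_function_Measure
    muC measurable_blocks).

Lemma block_law_fin : fin_num_fun block_law.
Proof.
apply: lty_fin_num_fun; rewrite -[ltLHS]/(muC setT).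
by rewrite probability_setT ltry.
Qed.

HB.instance Definition _ := @Measure_isFinite.Build _ _ _ block_law block_law_fin.

End block_law.
Arguments block_law {R d} l muC.

Section kernel_singular.
Context {R : realType} (d l : nat) (muC : probability (d.-tuple R) R).
Variables (nu : probability (l.-tuple R) R).
Variable K : R.-pker (l.-tuple R) ~> ((d - l).-tuple R).
Hypothesis hK : is_markov_kernel muC nu K.
Hypothesis ld : (l <= d)%N.
Hypothesis cube1 : muC (@cube R d) = 1%E.
Local Open Scope ereal_scope.

(** The kernel is a probability, so [nu] is determined by the kernel identity. *)
Lemma init_block_law (E : set (l.-tuple R)) : measurable E ->
  nu E = muC [set z | E (init_block l z)].
Proof.
move=> mE; have := hK.2 E setT mE measurableT.
rewrite (_ : [set z | _ /\ _] = [set z | E (init_block l z)]); last first.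
  by apply/seteqP; split => z /=; [case|].
move=> ->.
under eq_integral do rewrite prob_kernel.
by rewrite integral_cst// mul1e.
Qed.

Lemma init_block_cube : nu (@cube R l) = 1.
Proof.
have mc := @measurable_cube R l.
rewrite init_block_law//; apply/eqP; rewrite eq_le.
have mi : measurable [set z : d.-tuple R | cube (init_block l z)].
  by rewrite -[X in measurable X]setTI; exact: measurable_init_block.
rewrite probability_le1//= -cube1.
apply: le_measure; rewrite ?inE//; first exact: measurable_cube.
move=> z /cube_nthP cz /=; apply/cube_nthP => i il.
by rewrite (@nth_mktuple_nat _ l (nth 0%R z))//; apply: cz; exact: leq_trans ld.
Qed.

Lemma block_law_kernel (E : set (l.-tuple R)) (F : set ((d - l).-tuple R)) :
  measurable E -> measurable F ->
  block_law l muC (E `*` F) = \int[nu]_(x in E) K x F.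
Proof. exact: hK.2. Qed.

Lemma singular_kernelP :
  singular_kernel nu K <->
  mutually_singular (block_law l muC) (nu \x @lebesgue_cube R (d - l)).
Proof.
transitivity {ae nu, forall x, mutually_singular (K x) (@lebesgue_cube R (d - l))}.
  apply: iff_sym; apply: ae_fullP; first exact: measurable_cube.
  exact: init_block_cube.
split.
  exact: (@ae_singular_disintegration _ _ _ _ _ nu K (@lebesgue_cube R (d - l))
    (block_law l muC) block_law_kernel _ (@rat_orthant_gen R (d - l))
    (@rat_orthantI R (d - l)) erefl).
exact: (@singular_disintegration_ae _ _ _ _ _ nu K (@lebesgue_cube R (d - l))
    (block_law l muC) block_law_kernel).
Qed.

(** Absolute continuity [ac] makes the Lebesgue-exceptional set of sections
    negligible for [nu]. *)
Lemma singular_block_law :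
  (forall A : set (l.-tuple R), measurable A -> lebesgue_tuple l A = 0 ->
    muC [set z | A (init_block l z)] = 0) ->
  mutually_singular muC (@lebesgue_cube R d) ->
  mutually_singular (block_law l muC) (nu \x @lebesgue_cube R (d - l)).
Proof.
move=> ac [N [mN N0 N1]].
have mG := @measurable_merge_preimage R d l _ mN.
(* Null for [lebesgue_cube] means that the part inside the cube is null. *)
have mNc : measurable (N `&` @cube R d).
  by apply: measurableI => //; exact: measurable_cube.
exists (@merge_blocks R d l @^-1` N); split => //.
  rewrite -[RHS]N0 /block_law /pushforward; congr (muC _).
  by apply/seteqP; split => z /=; rewrite /blocks merge_blocksK.
apply/(product_null_xsection _ _ mG).
have [Q [mQ Q0 hQ]] := lebesgue_tuple_null_merge ld mNc N1.
have nuQ : nu Q = 0 by rewrite init_block_law//; exact: ac.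
exists (Q `|` ~` @cube R l); split.
- by apply: measurableU => //; apply: measurableC; exact: measurable_cube.
- apply/negligibleP.
    by apply: measurableU => //; apply: measurableC; exact: measurable_cube.
  apply: negligibleU; apply/negligibleP => //.
    by apply: measurableC; exact: measurable_cube.
  rewrite [LHS]probability_setC; last exact: measurable_cube.
  by rewrite init_block_cube subee.
- move=> x /= hx; have [cx|] := pselect (cube x); [left|by right].
  apply: hQ => /= h; apply: hx; rewrite -h /lebesgue_cube /mrestr.
  congr (lebesgue_tuple _ _); rewrite !xsectionE; apply/seteqP; split => t /=.
    by move=> [Nt ct]; split => //; apply/(cube_merge ld).
  by move=> [Nt /(cube_merge ld)[]].
Qed.

End kernel_singular.

(** For a single conditioning coordinate [nu] is the uniform law, and the
    recursion of [lebesgue_tuple] splits off that coordinate. The dimension is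
    written [n.+2] so that the types of the tail block and of the tail
    agree. *)
Lemma singular_of_block_law (R : realType) (n : nat)
    (muC : probability (n.+2.-tuple R) R) (nu : probability (1.-tuple R) R) :
  (forall E, measurable E -> nu E = muC [set z | E (init_block 1 z)]) ->
  (forall M : set R, measurable M ->
    muC [set z | M (tnth z ord0)] = lebesgueR (M `&` `[0, 1]%classic)) ->
  mutually_singular (block_law 1 muC) (nu \x @lebesgue_cube R n.+1)%E ->
  mutually_singular muC (@lebesgue_cube R n.+2).
Proof.
move=> nuE unif [N [mN N0 N1]].
have mB : measurable (@blocks R n.+2 1 @^-1` N).
  by rewrite -[X in measurable X]setTI; exact: measurable_blocks.
have mNc : measurable (@blocks R n.+2 1 @^-1` N `&` @cube R n.+2).
  by apply: measurableI => //; exact: measurable_cube.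
exists (@blocks R n.+2 1 @^-1` N); split => //.
have := (product_null_xsection _ _ mN).1 N1 => -[B [mB' B0 hB]].
rewrite /lebesgue_cube /mrestr lebesgue_tuple_consE.
apply/product_null_xsection; first exact: measurable_tuple_of_pair_preimage.
pose one (a : R) : 1.-tuple R := [tuple of [:: a]].
have mone : measurable_fun setT one.
  apply/measurable_fun_tnthP => i.
  rewrite (_ : _ \o _ = id); first exact: measurable_id.
  by apply/funext => a /=; rewrite (tnth_nth 0) (ord1 i).
have m1B : measurable (one @^-1` B).
  by rewrite -[X in measurable X]setTI; exact: mone.
exists (one @^-1` B `&` `[0, 1]%classic); split.
- by apply: measurableI => //; exact: measurable_itv.
- transitivity (muC [set z | (one @^-1` B) (tnth z ord0)]).
    by rewrite unif.
  have nuB0 : nu B = 0%E by exact: B0.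
  rewrite -nuB0 nuE//; congr (muC _).
  apply/seteqP; split => z /=.
    rewrite (_ : one _ = init_block 1 z)//; apply: eq_from_tnth => i.
    by rewrite tnth_mktuple (ord1 i) (tnth_nth 0)/= (tnth_nth 0).
  rewrite (_ : one _ = init_block 1 z)//; apply: eq_from_tnth => i.
  by rewrite tnth_mktuple (ord1 i) (tnth_nth 0)/= (tnth_nth 0).
- move=> a /= ha.
  have [a01|na] := boolP (0 <= a <= 1); last first.
    exfalso; apply: ha.
    rewrite (_ : xsection _ _ = set0) ?measure0//.
    apply/seteqP; split => t //=; rewrite xsectionE/= => -[_ ct].
    by move/negP : na; apply; exact: (ct ord0).
  split; last by rewrite in_itv.
  apply: hB => /= hN; apply: ha.
  have mx : measurable (xsection N (one a)) by exact: measurable_xsection.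
  have hN' : lebesgue_tuple n.+1 (xsection N (one a) `&` @cube R n.+1) = 0%E.
    exact: hN.
  apply: (subset_measure0 _ _ _ hN').
  - apply: measurable_xsection; exact: measurable_tuple_of_pair_preimage.
  - by apply: measurableI => //; exact: measurable_cube.
  - move=> t; rewrite !xsectionE/= => -[Nt ct]; split; last first.
      move=> i; have := ct (lift ord0 i).
      by rewrite tnthS.
    move: Nt; rewrite /blocks.
    rewrite (_ : init_block 1 _ = one a); last first.
      by apply: eq_from_tnth => i; rewrite tnth_mktuple (ord1 i).
    rewrite (_ : (@tail_block R n.+2 1 (tuple_of_pair (a, t)) : n.+1.-tuple R) = t)//.
    apply: eq_from_tnth => i; rewrite tnth_mktuple/=.
    by rewrite [RHS](tnth_nth 0).
Qed.

Theorem corollary5p2 (R : realType) (d : nat) (hd : (2 <= d)%N)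
    (C : d.-tuple R -> R) (hC : is_copula C) (hA : is_archimedean C)
    (muC : probability (d.-tuple R) R) (hmuC : induced_measure C muC)
    (muM : forall l : nat, probability (l.-tuple R) R)
    (hmuM : forall l : nat, (0 < l < d)%N ->
       induced_measure (@margin R d C l) (muM l))
    (K : forall l : nat, R.-pker (l.-tuple R) ~> ((d - l).-tuple R))
    (hK : forall l : nat, (0 < l < d)%N -> is_markov_kernel muC (muM l) (K l)) :
  mutually_singular muC (@lebesgue_cube R d) <->
  (forall l : nat, (0 < l < d)%N -> singular_kernel (muM l) (K l)).
Proof.
have [psi hpsi Cpsi] := hA.
have cube1 : muC (@cube R d) = 1%E by exact: law_cube hC hmuC (ltnW hd).
split => [sing l /[dup] l0d /andP[l0 ld]|sing].
  apply/(singular_kernelP (hK l l0d) (ltnW ld) cube1).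
  apply: (singular_block_law (hK l l0d) (ltnW ld) cube1) => // A mA A0.
  exact: (init_block_abs_continuous hC hmuC hpsi Cpsi ld mA A0).
have h1 := sing 1%N hd.
have := (singular_kernelP (hK 1%N hd) (ltnW hd) cube1).1 h1.
have init1 := init_block_law (hK 1%N hd).
have unif := fun i => law_coord hC hmuC (ltnW hd) i.
case: d hd C muC init1 unif {hC hA hmuC hmuM K hK Cpsi cube1 sing h1} =>
  [|[|n]] // _ C muC init1 unif.
exact: (singular_of_block_law init1 (unif ord0)).
Qed.
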